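(* Let $V$ be a finite set and let $f \in \mathbb{R}[t_i : i \in V]$ be a hereditary homogeneous polynomial of degree $d \geq 2$ such that the cone $\mathscr{K}_f$ is nonempty. Then $f$ is hereditary Lorentzian if and only if both of the following hold: (C) the skeleton $\tau\Delta_f$ is $H$-connected, and (Q) for each $S \in \Delta_f$ with $|S| = d-2$, the Hessian of the polynomial $f^S$ has at most one positive eigenvalue.
   Context: For $\mathbf{u} \in \mathbb{R}^V$ let $D_\mathbf{u} = \sum_{i} u_i \partial_i$, and for $S \subseteq V$ let $\partial^S = \prod_{i \in S}\partial_i$. For a homogeneous polynomial $f$, its lineality space is $L_f = \{\mathbf{v} : D_\mathbf{v} f \equiv 0\}$, and $\Delta_f = \{S \subseteq V : \partial^S f \not\equiv 0\}$ (a simplicial complex). The skeleton $\tau\Delta$ of a simplicial complex $\Delta$ is obtained by removing all facets. The link of $S \in \Delta$ is $\mathrm{lk}_\Delta(S) = \{T : T \cap S = \varnothing,\ S \cup T \in \Delta\}$ and $V_S$ denotes its vertex set. A pair $(\Delta, L)$ with $L \subseteq \mathbb{R}^V$ a linear subspace is hereditary if for every $T \in \Delta$ the map $L \to \mathbb{R}^T$, $\ell \mapsto (\ell_i)_{i \in T}$, is surjective. A homogeneous $f$ of degree $d \ge 1$ is hereditary if $(\tau\Delta_f, L_f)$ is hereditary. For $S \in \Delta_f$, $f^S = \partial^S f|_{t_i = 0,\, i \in S}$, viewed as a polynomial in $t_j$, $j \in V_S$ ($f^\varnothing = f$). For $S \in \tau\Delta_f$ and $i \in S$ choose $\ell^{(i)}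 \in L_f$ with $\ell^{(i)}_i = 1$ and $\ell^{(i)}_j = 0$ for $j \in S\setminus\{i\}$, and define $\pi_S : \mathbb{R}^V \to \mathbb{R}^{V_S}$ by $\pi_S(\mathbf{x}) = (y_j)_{j \in V_S}$ where $\mathbf{y} = \mathbf{x} - \sum_{i \in S} x_i \ell^{(i)}$. The cone $\mathscr{K}_f$ is defined recursively: if $\deg f = 1$, $\mathscr{K}_f = \{\mathbf{v} : f(\mathbf{v}) > 0\}$; if $\deg f > 1$, $\mathscr{K}_f = (\mathbb{R}_{>0}^V + L_f) \cap \{\mathbf{v} : \pi_{\{i\}}(\mathbf{v}) \in \mathscr{K}_{f^{\{i\}}} \text{ for all } i \in V \text{ with } \{i\}\in\Delta_f\}$ (independent of choices). For an open convex cone $\mathscr{K} \subseteq \mathbb{R}^n$, a homogeneous polynomial $g$ of degree $d \geq 1$ is $\mathscr{K}$-Lorentzian if for all $\mathbf{v}_1,\dots,\mathbf{v}_d \in \mathscr{K}$: $D_{\mathbf{v}_1}\cdots D_{\mathbf{v}_d} g > 0$, and (when $d \ge 2$) the bilinear form $(\mathbf{x},\mathbf{y}) \mapsto D_\mathbf{x} D_\mathbf{y} D_{\mathbf{v}_3}\cdots D_{\mathbf{v}_d} g$ has exactly one positive eigenvalue; nonnegative constants are $\mathscr{K}$-Lorentzian. A hereditary $f$ is hereditary Lorentzian if $f^S$ is $\mathscr{K}_{f^S}$-Lorentzian for every $S \in \tau\Delta_f$. A pure $(d-1)$-dimensional simplicial complex $\Delta$ is $H$-connected if $\mathrm{lk}_\Delta(S)$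 is connected for each $S \in \Delta$ with $|S| \le d-2$ (any zero-dimensional complex is $H$-connected). *)

(* Defs.v *)
From HB Require Import structures.
From mathcomp Require Import all_boot all_order all_algebra.
From mathcomp Require Import reals.
From mathcomp Require Import mpoly.

Set Implicit Arguments.
Unset Strict Implicit.
Unset Printing Implicit Defensive.

Import Order.TTheory GRing.Theory Num.Theory.
Local Open Scope ring_scope.

(* The ground set V is 'I_n.  For W : {set 'I_n}, the space R^W is the
   coordinate subspace of 'rV[R]_n of the vectors supported on W, and a
   polynomial in the variables t_j, j in W, is an element of {mpoly R[n]} in
   which no other variable occurs. *)

Section SimplicialComplexes.
Context {n : nat}.
Implicit Types (D : {set {set 'I_n}}) (S T : {set 'I_n}).

Definition facet D S : bool :=
  (S \in D) && [forall T in D, ~~ (S \proper T)].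

Definition skeleton D : {set {set 'I_n}} := [set S in D | ~~ facet D S].

Definition link D S : {set {set 'I_n}} :=
  [set T : {set 'I_n} | [disjoint T & S] && (S :|: T \in D)].

Definition vertices D : {set 'I_n} := [set i | [set i] \in D].

(* The dimension of D plus one. *)
Definition cpx_rank D : nat := \max_(S in D) #|S|.

Definition pure D : Prop := forall S, facet D S -> #|S| = cpx_rank D.

Definition connected D : Prop :=
  forall i j, i \in vertices D -> j \in vertices D ->
    connect (fun a b => [set a; b] \in D) i j.

Definition H_connected D : Prop :=
  pure D /\
  forall S, S \in D -> (#|S| + 2 <= cpx_rank D)%N -> connected (link D S).

End SimplicialComplexes.

Section Eigenvalues.
Context {R : realType} {m : nat}.
Implicit Types A : 'M[R]_m.

(* s lists the eigenvalues of A with algebraic multiplicity. *)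
Definition spectrum A (s : seq R) : Prop :=
  char_poly A = \prod_(a <- s) ('X - a%:P).

Definition exactly_one_pos_eigenvalue A : Prop :=
  exists2 s, spectrum A s & count (fun a => 0 < a) s = 1%N.

Definition at_most_one_pos_eigenvalue A : Prop :=
  exists2 s, spectrum A s & (count (fun a => 0%R < a)%R s <= 1)%N.

End Eigenvalues.

Section Hereditary.
Context {R : realType} {n : nat}.
Implicit Types (f g : {mpoly R[n]}) (u v x y : 'rV[R]_n).
Implicit Types (S T W : {set 'I_n}) (d : nat).

Definition supported W v : Prop := forall i, i \notin W -> v 0 i = 0.

Definition dirD v f : {mpoly R[n]} := \sum_(i < n) v 0 i *: f^`M(i).

Definition iterD (vs : seq 'rV[R]_n) f : {mpoly R[n]} := foldr dirD f vs.

Definition partialS S f : {mpoly R[n]} := f^`M[mesym1 S].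

Definition Delta f : {set {set 'I_n}} := [set S : {set 'I_n} | partialS S f != 0].

Definition lineality W f v : Prop := supported W v /\ dirD v f = 0.

Definition hereditary_pair (D : {set {set 'I_n}}) (L : 'rV[R]_n -> Prop) :
    Prop :=
  forall T, T \in D -> forall c : 'I_n -> R,
    exists2 l, L l & forall i, i \in T -> l 0 i = c i.

Definition hereditary f : Prop :=
  hereditary_pair (skeleton (Delta f)) (lineality setT f).

Definition linkV f S : {set 'I_n} := vertices (link (Delta f) S).

(* f^S: it only involves the variables in linkV f S. *)
Definition linkpoly f S : {mpoly R[n]} :=
  partialS S f \mPo [tuple (if i \in S then 0 else 'X_i) | i < n].

(* y = pi_S(x) for some admissible choice of the vectors l^(i), where f is a
   polynomial in the variables indexed by W. *)
Definition is_pi W f S x y : Prop :=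
  exists l : 'I_n -> 'rV[R]_n,
    (forall i, i \in S ->
       [/\ lineality W f (l i), l i 0 i = 1 &
           forall j, j \in S -> j != i -> l i 0 j = 0]) /\
    y = \row_j (if j \in linkV f S
                then (x - \sum_(i in S) x 0 i *: l i) 0 j else 0).

Definition posorthant W v : Prop :=
  supported W v /\ forall i, i \in W -> 0 < v 0 i.

(* The cone K_f in R^W of a polynomial f of degree d >= 1 in the variables
   indexed by W; the value at d = 0 is a dummy.  As pi_{i}(v) is required to
   exist, the cone is empty when some {i} is a facet of Delta f and d > 1. *)
Fixpoint hcone d W f v {struct d} : Prop :=
  match d with
  | 0 => False
  | d'.+1 =>
    match d' with
    | 0 => supported W v /\ 0 < f.@[v 0]
    | _ =>
      (exists p l, [/\ posorthant W p, lineality W f l & v = p + l]) /\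
      forall i, [set i] \in Delta f ->
        exists2 y, is_pi W f [set i] v y &
                   hcone d' (linkV f [set i]) (linkpoly f [set i]) y
    end
  end.

(* The Hessian, in the variables indexed by W, of a polynomial of degree at
   most 2 (so that its second derivatives are constants); it is also the matrix
   of the bilinear form (x, y) |-> D_x D_y g on R^W in the standard basis. *)
Definition hessian W g : 'M[R]_#|W| :=
  \matrix_(i, j) (g^`M(enum_val i)^`M(enum_val j))@_0%MM.

(* d is the degree of g, and K is a cone in R^W. *)
Definition lorentzian d W (K : 'rV[R]_n -> Prop) g : Prop :=
  match d with
  | 0 => 0 <= g@_0%MM
  | _ =>
    forall vs : d.-tuple 'rV[R]_n, (forall k, K (tnth vs k)) ->
      0 < (iterD vs g)@_0%MM /\
      ((2 <= d)%N ->
       exactly_one_pos_eigenvalue (hessian W (iterD (drop 2 vs) g)))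
  end.

(* d is the degree of f, so d - #|S| is the degree of f^S. *)
Definition hereditary_lorentzian d f : Prop :=
  hereditary f /\
  forall S, S \in skeleton (Delta f) ->
    lorentzian (d - #|S|) (linkV f S)
      (hcone (d - #|S|) (linkV f S) (linkpoly f S)) (linkpoly f S).

End Hereditary.

(* Main.v *)
Require Import Defs.
From HB Require Import structures.
From mathcomp Require Import all_boot all_order all_algebra.
From mathcomp Require Import reals.
From mathcomp Require Import mpoly.
From mathcomp Require Import complex ring lra zify.
Import Order.TTheory GRing.Theory Num.Theory.
(* Again, because all_boot has a lemma named iterD. *)
Import Defs.
Local Open Scope ring_scope.

Set Implicit Arguments.
Unset Strict Implicit.
Unset Printing Implicit Defensive.

(** Since L_f kills every derivative of f, restricting to t_S = 0 loses no
    information on the derivative of f along S, so that all the polynomials f^S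
    can be replaced by partialS S f and their cones by cones in R^V.

    If (C) and (Q) hold, the signature is propagated from links to f by induction
    on the degree.  Let H be the Hessian of D_{v_3} ... D_{v_d} f and write
    v_3 = p + l with p > 0 and l in L_f.  Then H = sum_i p_i H_i, where H_i is the
    Hessian of D_{v_4} ... D_{v_d} (d_i f), which is Lorentzian with
    H_i(v_3, v_3) = (H v_3)_i = (H p)_i > 0 and H_i(x, v_3) = (H x)_i.  The reverse
    Cauchy-Schwarz inequality for the H_i gives x H x <= x H M H x with
    M = diag (p_i / (H p)_i), so M H has no eigenvalue in ]0, 1[.  By
    Perron-Frobenius and the connectedness of the 1-skeleton, its largest
    eigenvalue is 1 and is simple, with eigenvector p.

    Conversely, if the 1-skeleton of a link splits into A and B, the restrictions
    of p to A and B span a plane on which H is positive definite. *)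

(** * Symmetric real matrices *)

Section RealSpectral.
Variable R : realType.

Lemma sumr_gt0_at (I : finType) (P : pred I) (F : I -> R) i0 :
  (forall i, P i -> 0 <= F i) -> P i0 -> 0 < F i0 -> 0 < \sum_(i | P i) F i.
Proof.
move=> F0 Pi Fi; rewrite (bigD1 i0) //= ltr_pwDl // sumr_ge0 // => i /andP[Pi' _].
exact: F0.
Qed.

(** A complex eigenvector [v] exists; evaluating v A v* from either side of the real symmetric [A]
    gives c = conj c, so [c] is a real root of the characteristic polynomial. *)
Lemma symmetric_eigenvalue m (A : 'M[R]_m.+1) :
  A^T = A -> exists a, eigenvalue A a.
Proof.
move=> Asym; pose toC := real_complex R; pose AC := map_mx toC A.
have [c] := eigenvalue_closed AC (ltn0Sn m).
move=> ec; have /eigenvalueP[v vA v0] := ec.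
have ACJ : (map_mx Num.conj AC)^T = AC.
  apply/matrixP => i j; rewrite !mxE.
  have -> : A j i = A i j by rewrite -[in LHS]Asym mxE.
  exact: conjc_real.
pose vs := (map_mx Num.conj v)^T.
have E : v *m AC *m vs = c *: (v *m vs) by rewrite vA scalemxAl.
have N : (v *m vs) 0 0 = \sum_i `|v 0 i| ^+ 2.
  by rewrite mxE; apply: eq_bigr => i _; rewrite !mxE normCK.
have N0 : (v *m vs) 0 0 != 0.
  rewrite N; apply: contra v0 => /eqP/psumr_eq0P H; apply/eqP/rowP => i.
  rewrite mxE; apply/eqP; rewrite -normr_eq0 -sqrf_eq0; apply/eqP.
  by apply: H => // j _; rewrite exprn_ge0.
have E' : v *m AC *m vs = Num.conj c *: (v *m vs).
  have /(congr1 (map_mx Num.conj)) := vA.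
  rewrite map_mxM map_mxZ => /(congr1 trmx); rewrite trmx_mul ACJ linearZ /= => e.
  by rewrite -mulmxA e scalemxAr.
have cR : c \is Num.real.
  apply/CrealP; move: E; rewrite E' => /matrixP/(_ 0 0); rewrite !mxE => e.
  apply: (mulIf N0); rewrite mxE; exact: e.
have [r cr] := complex_realP _ cR.
exists r; move: ec; rewrite !eigenvalue_root_char cr -map_char_poly.
by rewrite fmorph_root.
Qed.

Definition bform m (A : 'M[R]_m) (x y : 'rV[R]_m) : R := (x *m A *m y^T) 0 0.

Lemma bformDl m (A : 'M[R]_m) x y z : bform A (x + y) z = bform A x z + bform A y z.
Proof. by rewrite /bform !mulmxDl mxE. Qed.

Lemma bformZl m (A : 'M[R]_m) c x z : bform A (c *: x) z = c * bform A x z.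
Proof. by rewrite /bform -!scalemxAl mxE. Qed.

Lemma bformC m (A : 'M[R]_m) x y : A^T = A -> bform A x y = bform A y x.
Proof.
move=> As; rewrite /bform -[LHS](_ : (x *m A *m y^T)^T 0 0 = _); last by rewrite mxE.
by rewrite !trmx_mul trmxK As mulmxA.
Qed.

Lemma bformE m (A : 'M[R]_m) x y :
  bform A x y = \sum_i \sum_j x 0 i * A i j * y 0 j.
Proof.
rewrite /bform mxE exchange_big /=; apply: eq_bigr => j _.
by rewrite !mxE mulr_suml.
Qed.

Lemma dot_gt0 m (x : 'rV[R]_m) : x != 0 -> 0 < (x *m x^T) 0 0.
Proof.
move=> x0; have [i xi] : exists i, x 0 i != 0.
  apply/existsP; apply: contraR x0; rewrite negb_exists => /forallP H.
  by apply/eqP/rowP => i; rewrite mxE; apply/eqP; rewrite -[_ == _]negbK.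
rewrite mxE (bigD1 i) //= mxE -expr2 ltr_pwDl ?exprn_even_gt0 //.
by apply: sumr_ge0 => j _; rewrite mxE -expr2 sqr_ge0.
Qed.

(* The Householder reflection along u - v. *)
Lemma reflection_exists m (u v : 'rV[R]_m) :
  u *m u^T = 1%:M -> v *m v^T = 1%:M ->
  exists Q : 'M[R]_m, [/\ Q *m Q^T = 1%:M & u *m Q = v].
Proof.
move=> uu vv; have [->|uv] := eqVneq u v.
  by exists 1%:M; rewrite trmx1 !mulmx1.
pose w := u - v; have w0 : w != 0 by rewrite subr_eq0.
pose s := (w *m w^T) 0 0; have s0 : s != 0 by rewrite gt_eqF // dot_gt0.
have ws : w *m w^T = s%:M by rewrite [LHS]mx11_scalar.
pose c := (u *m v^T) 0 0.
have uvc : u *m v^T = c%:M by rewrite [LHS]mx11_scalar.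
have vuc : v *m u^T = c%:M.
  by rewrite -[LHS]trmxK trmx_mul trmxK uvc tr_scalar_mx.
have sE : s = 2 - 2 * c.
  rewrite /s /w linearB /= mulmxBl !mulmxBr uu vv uvc vuc !mxE eqxx /= !mulr1n.
  ring.
pose Q := 1%:M - (2 / s) *: (w^T *m w).
have Qt : Q^T = Q by rewrite /Q linearB linearZ /= trmx1 trmx_mul trmxK.
exists Q; split.
  have WW : w^T *m w *m (w^T *m w) = s *: (w^T *m w).
    by rewrite mulmxA -[w^T *m w *m w^T]mulmxA ws mul_mx_scalar -scalemxAl.
  rewrite Qt /Q mulmxBr mulmx1 mulmxBl mul1mx -scalemxAl -scalemxAr WW !scalerA.
  have -> : 2 / s * (2 / s) * s = 2 / s + 2 / s by field.
  by rewrite scalerDl opprB addrK subrK.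
rewrite /Q mulmxBr mulmx1 -scalemxAr mulmxA.
have -> : u *m w^T = (1 - c)%:M.
  by rewrite /w linearB /= mulmxBr uu uvc -raddfB.
have e : 2 / s * (1 - c) = 1.
  have -> : 1 - c = s / 2 by rewrite sE; field.
  by field.
by rewrite mul_scalar_mx scalerA e scale1r /w opprB addrC subrK.
Qed.

(** Induction on the size: a reflection carries the first basis vector to a unit eigenvector, and
    symmetry then makes the conjugate [B] block diagonal. *)
Lemma real_spectral m (A : 'M[R]_m) : A^T = A ->
  exists P : 'M[R]_m, exists D : 'rV[R]_m,
    P *m P^T = 1%:M /\ P *m A *m P^T = diag_mx D.
Proof.
elim: m A => [|m IH] A Asym.
  by exists 1%:M, 0; split; apply/matrixP => -[].
have [a /eigenvalueP[v0 vA vn0]] := symmetric_eigenvalue Asym.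
pose s := (v0 *m v0^T) 0 0; have s0 : 0 < s by exact: dot_gt0.
pose v := (Num.sqrt s)^-1 *: v0.
have vv : v *m v^T = 1%:M.
  rewrite /v linearZ /= -scalemxAl -scalemxAr scalerA [v0 *m _]mx11_scalar -/s.
  by rewrite scale_scalar_mx -invfM -expr2 sqr_sqrtr ?ltW // mulVf ?gt_eqF.
have vAv : v *m A = a *: v by rewrite /v -scalemxAl vA !scalerA mulrC.
pose e : 'rV[R]_(1 + m) := delta_mx 0 0.
have ee : e *m e^T = 1%:M.
  by rewrite /e trmx_delta mul_delta_mx; apply/matrixP => i j; rewrite !ord1 !mxE.
have [Q [QQ eQ]] := reflection_exists ee vv.
have QtQ : Q^T *m Q = 1%:M by apply: mulmx1C.
pose B : 'M[R]_(1 + m) := Q *m A *m Q^T.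
have Bs : B^T = B by rewrite /B !trmx_mul trmxK Asym mulmxA.
have eB : e *m B = a *: e.
  rewrite /B !mulmxA eQ vAv -scalemxAl -eQ -mulmxA QQ mulmx1 //.
have Bdef : B = Q *m A *m Q^T by [].
clearbody B; pose C := drsubmx B.
have Cs : C^T = C by rewrite /C trmx_drsub Bs.
have BE : B = block_mx a%:M 0 0 C.
  have r0 (i j : 'I_(1 + m)) : i = 0%N :> nat -> B i j = a *+ (j == 0%N :> nat).
    move=> i0; have -> : i = 0 by apply: val_inj.
    have /rowP/(_ j) := eB; rewrite -rowE !mxE eqxx /= => ->.
    by rewrite mulr_natr.
  rewrite -[B]submxK -/C; congr block_mx.
  - by apply/matrixP => i j; rewrite !ord1 !mxE r0.
  - by apply/matrixP => i j; rewrite !ord1 !mxE r0.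
  - by apply/matrixP => i j; rewrite !ord1 !mxE -Bs mxE r0.
have [P [D [PP PC]]] := IH C Cs.
pose P1 : 'M[R]_(1 + m) := block_mx 1%:M 0 0 P.
have P1P1 : P1 *m P1^T = 1%:M.
  rewrite /P1 tr_block_mx mulmx_block !trmx0 !(mul0mx, mulmx0, add0r, addr0).
  by rewrite trmx1 mulmx1 PP -scalar_mx_block.
exists (P1 *m Q), (row_mx a%:M D); split.
  by rewrite trmx_mul mulmxA -[P1 *m Q *m _]mulmxA QQ mulmx1.
have -> : P1 *m Q *m A *m (P1 *m Q)^T = P1 *m B *m P1^T.
  by rewrite trmx_mul Bdef !mulmxA.
rewrite BE /P1 tr_block_mx !mulmx_block !trmx0 !(mul0mx, mulmx0, add0r, addr0).
rewrite trmx1 mulmx1 mul1mx PC.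
rewrite [X in block_mx X _ _ _](_ : _ = diag_mx (a%:M : 'rV[R]_1)).
  by rewrite -diag_mx_row.
by apply/matrixP => i j; rewrite !ord1 !mxE.
Qed.

Lemma bform_diag m (P A : 'M[R]_m) D (x y : 'rV[R]_m) :
  P *m P^T = 1%:M -> P *m A *m P^T = diag_mx D ->
  bform A x y = \sum_k D 0 k * (x *m P^T) 0 k * (y *m P^T) 0 k.
Proof.
move=> PP PA; have PtP := mulmx1C PP.
have -> : A = P^T *m diag_mx D *m P.
  by rewrite -PA !mulmxA PtP mul1mx -mulmxA PtP mulmx1.
rewrite /bform !mulmxA -[_ *m P *m _]mulmxA.
have -> : P *m y^T = (y *m P^T)^T by rewrite trmx_mul trmxK.
rewrite mxE; apply: eq_bigr => k _.
rewrite [X in _ * X]mxE -[x *m _ *m _]/(x *m P^T *m diag_mx D) mul_mx_diag mxE.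
by rewrite [D 0 k * _]mulrC.
Qed.

Lemma char_poly_orthodiag m (P A : 'M[R]_m) D :
  P *m P^T = 1%:M -> P *m A *m P^T = diag_mx D ->
  spectrum A [seq D 0 k | k <- enum 'I_m].
Proof.
move=> PP PA; have PtP := mulmx1C PP.
have PPX : map_mx polyC P *m map_mx polyC P^T = 1%:M.
  by rewrite -map_mxM PP map_mx1.
have E : char_poly A = char_poly (diag_mx D).
  rewrite -PA /char_poly /char_poly_mx.
  have -> : 'X%:M - map_mx polyC (P *m A *m P^T)
      = map_mx polyC P *m ('X%:M - map_mx polyC A) *m map_mx polyC P^T.
    rewrite mulmxBr mulmxBl !map_mxM; congr (_ - _).
    by rewrite scalar_mxC -mulmxA PPX mulmx1.
  by rewrite !det_mulmx mulrAC -det_mulmx PPX det1 mul1r.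
rewrite /spectrum E char_poly_trig ?diag_mx_is_trig //.
rewrite big_map big_enum /=; apply: eq_bigr => i _.
by rewrite !mxE eqxx.
Qed.

(* For symmetric bilinear forms: at most one positive eigenvalue. *)
Definition lorentz_form (T : Type) (q : T -> T -> R) : Prop :=
  forall x w, 0 < q w w -> q x x * q w w <= q x w ^+ 2.

(** Completing the square: c (a - 2 t b + t^2 c) = a c - b^2 + (t c - b)^2. Thus one nonpositive
    value of a form on the line x - t w gives reverse Cauchy-Schwarz. *)
Lemma quad_le0_lorentz (a b c t : R) :
  0 < c -> a - 2 * t * b + t ^+ 2 * c <= 0 -> a * c <= b ^+ 2.
Proof.
move=> c0 H; have : (a - 2 * t * b + t ^+ 2 * c) * c <= 0 by rewrite pmulr_lle0.
have := sqr_ge0 (t * c - b); nra.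
Qed.

Lemma bformB m (A : 'M[R]_m) x w t : A^T = A ->
  bform A (x - t *: w) (x - t *: w) =
    bform A x x - 2 * t * bform A x w + t ^+ 2 * bform A w w.
Proof.
move=> As; rewrite -scaleNr bformDl bformZl ![bform A _ (x + _)]bformC //.
rewrite !bformDl !bformZl (bformC w x As); ring.
Qed.

Lemma spectrum_count m (A : 'M[R]_m) s t :
  spectrum A s -> spectrum A t ->
  count (fun a => 0 < a) s = count (fun a => 0 < a) t.
Proof. by rewrite /spectrum => -> /prod_XsubC_eq/permP. Qed.

Lemma count_enum_ord m (D : 'rV[R]_m) :
  count (fun a => 0 < a) [seq D 0 k | k <- enum 'I_m] = #|[pred k | 0 < D 0 k]|.
Proof. by rewrite count_map enumT cardE /enum_mem size_filter. Qed.

Lemma at_most_one_pos_lorentz m (A : 'M[R]_m) : A^T = A ->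
  at_most_one_pos_eigenvalue A -> lorentz_form (bform A).
Proof.
move=> As [s sA s1] x w ww.
have [P [D [PP PA]]] := real_spectral As.
have := char_poly_orthodiag PP PA => /(spectrum_count sA) cE.
move: s1; rewrite cE count_enum_ord => D1.
have q z := bform_diag z z PP PA.
have [k0 Dk0] : exists k, 0 < D 0 k.
  apply/existsP; apply: contraLR ww; rewrite negb_exists => /forallP H.
  rewrite -leNgt q; apply: sumr_le0 => k _.
  by rewrite -mulrA -expr2 mulr_le0_ge0 ?sqr_ge0 // leNgt.
have Dk k : k != k0 -> D 0 k <= 0.
  move=> kk; rewrite leNgt; apply: contraL D1 => Dk; rewrite -ltnNge.
  by apply/card_gt1P; exists k, k0; rewrite !inE.
have w0 : (w *m P^T) 0 k0 != 0.
  apply: contraL ww => /eqP e; rewrite -leNgt q; apply: sumr_le0 => k _.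
  have [->|/Dk h] := eqVneq k k0; first by rewrite e mulr0.
  by rewrite -mulrA -expr2 mulr_le0_ge0 ?sqr_ge0.
(* This [t] cancels the coordinate of x - t w along [k0], the only eigenvector with positive
   eigenvalue. *)
pose t := (x *m P^T) 0 k0 / (w *m P^T) 0 k0.
apply: (@quad_le0_lorentz _ _ _ t) => //; rewrite -bformB // q.
apply: sumr_le0 => k _; rewrite -mulrA -expr2.
have [->|/Dk h] := eqVneq k k0; last by rewrite mulr_le0_ge0 ?sqr_ge0.
rewrite mulmxBl -scalemxAl.
have -> : forall u v : 'rV[R]_m, (u - t *: v) 0 k0 = u 0 k0 - t * v 0 k0.
  by move=> u v; rewrite !mxE.
by rewrite /t mulfVK // subrr expr0n mulr0.
Qed.

(** Two eigenvectors with positive eigenvalues would span a positive definite plane, which contains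
    a nonzero vector orthogonal to [w]; reverse Cauchy-Schwarz fails there. *)
Lemma lorentz_exactly_one_pos m (A : 'M[R]_m) w : A^T = A ->
  0 < bform A w w -> lorentz_form (bform A) -> exactly_one_pos_eigenvalue A.
Proof.
move=> As ww L.
have [P [D [PP PA]]] := real_spectral As.
exists [seq D 0 k | k <- enum 'I_m]; first exact: char_poly_orthodiag PP PA.
rewrite count_enum_ord; apply/eqP; rewrite eqn_leq; apply/andP; split; last first.
  rewrite lt0n; apply: contraL ww => /pred0P H.
  rewrite -leNgt (bform_diag _ _ PP PA); apply: sumr_le0 => k _.
  rewrite -mulrA -expr2 mulr_le0_ge0 ?sqr_ge0 // leNgt.
  by have /= -> := H k.
rewrite leqNgt; apply/negP => /card_gt1P[i [j [Di Dj ij]]].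
rewrite !inE in Di Dj.
have q k l : bform A (row k P) (row l P) = D 0 k *+ (k == l).
  have /matrixP/(_ k l) := PA; rewrite [RHS]mxE eq_sym => <-.
  rewrite /bform -row_mul tr_row !mxE; apply: eq_bigr => h _.
  by rewrite !mxE.
pose a := bform A (row i P) w; pose b := bform A (row j P) w.
have [a0|a0] := eqVneq a 0.
  have := L (row i P) w ww; rewrite q eqxx mulr1n -/a a0 expr0n /=.
  by rewrite leNgt mulr_gt0.
pose u := row j P - (b / a) *: row i P.
have uw : bform A u w = 0.
  by rewrite /u -scaleNr bformDl bformZl -/a -/b mulNr mulfVK // subrr.
have := L u w ww; rewrite uw expr0n /= leNgt mulr_gt0 //.
rewrite /u bformB // !q !eqxx (eq_sym j) (negPf ij) mulr0n mulr0 subr0 !mulr1n.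
by rewrite ltr_pwDl // mulr_ge0 ?sqr_ge0 // ltW.
Qed.

(** As its square is positive, [w] lies off the hyperplane orthogonal to [v], so the line x - t w
    meets that hyperplane. *)
Lemma hyperplane_lorentz m (A : 'M[R]_m) v : A^T = A ->
  (forall x, bform A x v = 0 -> bform A x x <= 0) -> lorentz_form (bform A).
Proof.
move=> As H x w ww; have wv : bform A w v != 0.
  by apply: contraL ww => /eqP/H; rewrite -leNgt.
apply: (@quad_le0_lorentz _ _ _ (bform A x v / bform A w v)) => //.
rewrite -bformB //; apply: H.
by rewrite -scaleNr bformDl bformZl mulNr mulfVK // subrr.
Qed.

Lemma exactly_at_most_one_pos m (A : 'M[R]_m) :
  exactly_one_pos_eigenvalue A -> at_most_one_pos_eigenvalue A.
Proof. by move=> [s sA s1]; exists s => //; rewrite s1. Qed.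

(* With M = diag(p / Hp), the operator MH is self-adjoint for M^-1: the last
   hypothesis leaves no eigenvalue in ]0, 1[, the nonnegativity of the
   off-diagonal entries none in ]1, +oo[, and connectivity makes 1 simple. *)
Lemma trickling_down m (H : 'M[R]_m) (p : 'rV[R]_m) :
  H^T = H -> (forall i, 0 < p 0 i) -> (forall i, 0 < (p *m H) 0 i) ->
  (forall i j, i != j -> 0 <= H i j) ->
  (forall z : 'I_m -> R, (forall i j, i != j -> 0 < H i j -> z i = z j) ->
     forall i j, z i = z j) ->
  (forall x, bform H x x <= \sum_i p 0 i * (x *m H) 0 i ^+ 2 / (p *m H) 0 i) ->
  forall x, bform H x p = 0 -> bform H x x <= 0.
Proof.
move=> Hs p0 h0 Hij Hc Hq x xp.
pose h i := (p *m H) 0 i.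
have hE i : h i = \sum_j H i j * p 0 j.
  rewrite /h mxE; apply: eq_bigr => j _; rewrite mulrC -[in RHS]Hs mxE //.
(* With M = diag (r^2), the matrix [A] below is symmetric and similar to M H, so it can be
   diagonalized orthogonally; [sc] carries the form of [A] to that of [H]. *)
pose r i := Num.sqrt (p 0 i / h i).
have r0 i : 0 < r i by rewrite sqrtr_gt0 divr_gt0.
have rr i : r i ^+ 2 = p 0 i / h i by rewrite sqr_sqrtr // ltW // divr_gt0.
pose A := \matrix_(i, j) (r i * H i j * r j).
have As : A^T = A.
  by apply/matrixP => i j; rewrite !mxE -[in RHS]Hs mxE; ring.
have [P [D [PP PA]]] := real_spectral As.
pose sc (y : 'rV[R]_m) := \row_i (y 0 i * r i).
have AH y z : bform A y z = bform H (sc y) (sc z).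
  rewrite !bformE; apply: eq_bigr => i _; apply: eq_bigr => j _; rewrite !mxE.
  ring.
pose y := \row_i (x 0 i / r i).
have yx : sc y = x by apply/rowP => i; rewrite !mxE mulfVK ?gt_eqF.
rewrite -yx -AH (bform_diag _ _ PP PA).
pose g := \row_i (p 0 i / r i).
have gp : sc g = p by apply/rowP => i; rewrite !mxE mulfVK ?gt_eqF.
have rowA k : row k P *m A = D 0 k *: row k P.
  rewrite -row_mul -[P *m A]mulmx1 -(mulmx1C PP) mulmxA PA row_mul.
  by rewrite row_diag_mx -scalemxAl -rowE.
have rown k l : (row k P *m (row l P)^T) 0 0 = (k == l)%:R.
  have /matrixP/(_ k l) := PP; rewrite [RHS]mxE => <-.
  by rewrite !mxE; apply: eq_bigr => i _; rewrite !mxE.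
(* At the image under [sc] of a unit eigenvector with eigenvalue D, the hypothesis [Hq] reads D <=
   D^2. *)
have gap k : 0 < D 0 k -> 1 <= D 0 k.
  move=> Dk; have := Hq (sc (row k P)); rewrite -AH /bform rowA -scalemxAl mxE rown.
  rewrite eqxx mulr1.
  have -> : \sum_i p 0 i * (sc (row k P) *m H) 0 i ^+ 2 / (p *m H) 0 i
     = D 0 k ^+ 2 * (row k P *m (row k P)^T) 0 0.
    rewrite mxE mulr_sumr; apply: eq_bigr => i _.
    rewrite [(row k P)^T _ _]mxE.
    have -> : (sc (row k P) *m H) 0 i = (row k P *m A) 0 i / r i.
      rewrite mxE [in RHS]mxE mulr_suml; apply: eq_bigr => j _.
      by rewrite !mxE; field; rewrite gt_eqF.
    have -> : (row k P *m A) 0 i = D 0 k * row k P 0 i by rewrite rowA mxE.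
    rewrite -/(h i).
    have -> : p 0 i = r i ^+ 2 * h i by rewrite rr mulfVK ?gt_eqF.
    by field; rewrite !gt_eqF //=; exact: h0.
  rewrite rown eqxx mulr1; nra.
have perron k : 1 <= D 0 k -> exists c, row k P = c *: g.
  move=> Dk; pose s := sc (row k P); pose z i := s 0 i / p 0 i.
  have sz i : s 0 i = z i * p 0 i by rewrite /z mulfVK ?gt_eqF.
  (* A weighted Dirichlet energy: by [TS], [e1] and [e2] the terms sum to 2 (1 - D 0 k) <= 0, and
     each is nonnegative. So all vanish, and [z] is constant along positive off-diagonal entries. *)
  pose T i j := H i j * p 0 i * p 0 j * (z i - z j) ^+ 2.
  have T0 i j : 0 <= T i j.
    have [->|ij] := eqVneq i j; first by rewrite /T subrr expr0n mulr0.
    by apply: mulr_ge0 (sqr_ge0 _); rewrite !mulr_ge0 ?Hij ?(ltW (p0 _)).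
  have Hsym i j : H j i = H i j by rewrite -[in LHS]Hs mxE.
  have TS : \sum_i \sum_j T i j =
      2 * (\sum_i h i * p 0 i * z i ^+ 2) - 2 * bform H s s.
    pose U i j := H i j * p 0 j * p 0 i * z i ^+ 2.
    have US : \sum_i \sum_j U i j = \sum_i h i * p 0 i * z i ^+ 2.
      by apply: eq_bigr => i _; rewrite hE !mulr_suml.
    rewrite mulr_natl mulr2n -{1}US -US [X in _ + X - _]exchange_big bformE.
    rewrite -big_split mulr_sumr -sumrB; apply: eq_bigr => i _ /=.
    rewrite -big_split mulr_sumr -sumrB; apply: eq_bigr => j _ /=.
    rewrite /U /T !sz Hsym; ring.
  have e1 : \sum_i h i * p 0 i * z i ^+ 2 = 1.
    rewrite -[RHS](_ : (row k P *m (row k P)^T) 0 0 = 1); last by rewrite rown eqxx.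
    rewrite mxE; apply: eq_bigr => i _; rewrite [(row k P)^T _ _]mxE.
    have -> : z i = row k P 0 i * r i / p 0 i by rewrite /z /s mxE.
    have -> : p 0 i = r i ^+ 2 * h i by rewrite rr mulfVK ?gt_eqF.
    by field; rewrite !gt_eqF //=; exact: h0.
  have e2 : bform H s s = D 0 k.
    by rewrite -AH /bform rowA -scalemxAl mxE rown eqxx mulr1.
  have TS0 : \sum_i \sum_j T i j = 0.
    apply/eqP; rewrite eq_le; apply/andP; split; last first.
      by apply: sumr_ge0 => i _; apply: sumr_ge0.
    by rewrite TS e1 e2; lra.
  have Tz i j : T i j = 0.
    have /psumr_eq0P H1 := TS0.
    have /psumr_eq0P H2 := H1 (fun i _ => sumr_ge0 _ (fun j _ => T0 i j)) i isT.
    by apply: H2.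
  have zc : forall i j, z i = z j.
    apply: Hc => i j ij Hp; apply/eqP; rewrite -subr_eq0 -sqrf_eq0.
    have /eqP := Tz i j; rewrite /T mulf_eq0 => /orP[|//].
    by rewrite gt_eqF // !mulr_gt0.
  case: (pickP (mem 'I_m)) => [i0 _|no]; last first.
    by exists 0; apply/rowP => i; have := no i.
  exists (z i0); apply/rowP => i; rewrite (zc _ i) [RHS]mxE /z /s !mxE.
  by field; rewrite !gt_eqF.
(* Eigenvectors with positive eigenvalue are multiples of [g], to which [y] is A-orthogonal; only
   nonpositive eigenvalues contribute at [y]. *)
have gy : bform A y g = 0 by rewrite AH yx gp.
apply: sumr_le0 => k _; rewrite -mulrA -expr2.
have [Dk|Dk] := leP (D 0 k) 0; first by rewrite mulr_le0_ge0 ?sqr_ge0.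
have [c cE] := perron k (gap k Dk).
suff -> : (y *m P^T) 0 k = 0 by rewrite expr0n mulr0.
have -> : (y *m P^T) 0 k = (row k P *m y^T) 0 0.
  by rewrite !mxE; apply: eq_bigr => i _; rewrite !mxE mulrC.
have : bform A (row k P) y = 0 by rewrite cE bformZl bformC // gy mulr0.
rewrite /bform rowA -scalemxAl mxE => /eqP; rewrite mulf_eq0 => /orP[|/eqP //].
by rewrite gt_eqF.
Qed.

End RealSpectral.

(** * Directional derivatives *)

Section DirectionalDerivatives.
Variables (R : realType) (n : nat).
Implicit Types (g : {mpoly R[n]}) (u v x y : 'rV[R]_n) (S T W : {set 'I_n}).
Implicit Types vs : seq 'rV[R]_n.

Definition unitv (i : 'I_n) : 'rV[R]_n := delta_mx 0 i.

Lemma dirD_unitv i g : dirD (unitv i) g = g^`M(i).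
Proof.
rewrite /dirD (bigD1 i) //= mxE !eqxx scale1r big1 ?addr0 // => j ji.
by rewrite mxE eqxx /= (negPf ji) scale0r.
Qed.

Lemma dirDDl u v g : dirD (u + v) g = dirD u g + dirD v g.
Proof. by rewrite /dirD -big_split; apply: eq_bigr => i _; rewrite mxE scalerDl. Qed.

Lemma dirDZl c u g : dirD (c *: u) g = c *: dirD u g.
Proof. by rewrite /dirD scaler_sumr; apply: eq_bigr => i _; rewrite mxE scalerA. Qed.

Lemma dirDNl u g : dirD (- u) g = - dirD u g.
Proof. by rewrite -scaleN1r dirDZl scaleN1r. Qed.

Lemma dirDBl u v g : dirD (u - v) g = dirD u g - dirD v g.
Proof. by rewrite dirDDl dirDNl. Qed.

Lemma dirD_suml (I : finType) (P : pred I) (F : I -> 'rV[R]_n) g :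
  dirD (\sum_(i | P i) F i) g = \sum_(i | P i) dirD (F i) g.
Proof.
elim/big_rec2: _ => [|i y u _ <-]; last by rewrite dirDDl.
by rewrite /dirD big1 // => i _; rewrite mxE scale0r.
Qed.

Fact dirD_is_linear u : linear (dirD u : {mpoly R[n]} -> {mpoly R[n]}).
Proof.
move=> c g h; rewrite /dirD scaler_sumr -big_split; apply: eq_bigr => i _ /=.
by rewrite linearP scalerDr !scalerA mulrC.
Qed.
HB.instance Definition _ u :=
  GRing.isLinear.Build R {mpoly R[n]} {mpoly R[n]} _ (dirD u) (dirD_is_linear u).

Lemma dirD_eq u v g : (forall j, u 0 j = v 0 j \/ g^`M(j) = 0) -> dirD u g = dirD v g.
Proof. by move=> H; apply: eq_bigr => j _; case: (H j) => ->; rewrite ?scaler0. Qed.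

Lemma dirD_mderiv u i g : dirD u g^`M(i) = (dirD u g)^`M(i).
Proof.
rewrite /dirD linear_sum /=; apply: eq_bigr => j _.
by rewrite linearZ /= mderiv_comm.
Qed.

Lemma dirDC u v g : dirD u (dirD v g) = dirD v (dirD u g).
Proof.
rewrite [dirD v g]/dirD linear_sum /=; apply: eq_bigr => i _.
by rewrite linearZ /= dirD_mderiv.
Qed.

Fact iterD_is_linear vs : linear (iterD vs : {mpoly R[n]} -> {mpoly R[n]}).
Proof. by elim: vs => [|u vs IH] c g h //=; rewrite IH linearP. Qed.
HB.instance Definition _ vs :=
  GRing.isLinear.Build R {mpoly R[n]} {mpoly R[n]} _ (iterD vs) (iterD_is_linear vs).

Lemma dirD_iterD u vs g : dirD u (iterD vs g) = iterD vs (dirD u g).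
Proof. by elim: vs => //= v vs IH; rewrite dirDC IH. Qed.

Lemma iterD_mderiv vs i g : iterD vs g^`M(i) = (iterD vs g)^`M(i).
Proof. by rewrite -!dirD_unitv dirD_iterD. Qed.

Lemma dirD_mderivm u m g : dirD u g^`M[m] = (dirD u g)^`M[m].
Proof.
rewrite /dirD linear_sum /=; apply: eq_bigr => i _.
by rewrite linearZ /= -!mderivmU1m -!mderivmDm addmC.
Qed.

Lemma dirD_partialS u S g : dirD u (partialS S g) = partialS S (dirD u g).
Proof. exact: dirD_mderivm. Qed.

(** * Derivatives along a face *)

Lemma partialS0 g : partialS set0 g = g.
Proof. by rewrite /partialS mesym1_set0 mderivm0m. Qed.

Lemma partialS1 i g : partialS [set i] g = g^`M(i).
Proof. by rewrite /partialS mesym1_set1 mderivmU1m. Qed.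

Lemma partialS_setU S T g : [disjoint T & S] ->
  partialS (S :|: T) g = partialS T (partialS S g).
Proof.
move=> ST; rewrite /partialS -mderivmDm; congr (g^`M[_]); apply/mnmP => i.
rewrite mnmDE !mnmE in_setU; case: (boolP (i \in T)) => iT.
  by rewrite (disjointFr ST iT).
by rewrite orbF addn0.
Qed.

Lemma partialS_setU1 i S g : i \notin S ->
  partialS (i |: S) g = (partialS S g)^`M(i).
Proof. by move=> iS; rewrite setUC partialS_setU ?disjoints1 // partialS1. Qed.

Lemma partialS_sub S T g : S \subset T ->
  partialS T g = partialS (T :\: S) (partialS S g).
Proof.
move=> ST; rewrite -partialS_setU; last by rewrite disjoints_subset setDE subsetIr.
by rewrite setDE setUIr setUCr setIT (setUidPr ST).
Qed.

Lemma mderiv_homog e i g : g \is e.-homog -> g^`M(i) \is e.-1.-homog.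
Proof.
move=> /dhomogP hg; apply/dhomogP => m.
rewrite mcoeff_msupp mcoeff_mderiv => H; have := hg (m + U_(i))%MM.
rewrite mcoeff_msupp /= mdegD mdeg1 addn1 => <- //.
by apply: contraNneq H => ->; rewrite mul0rn.
Qed.

Lemma dirD_homog e u g : g \is e.-homog -> dirD u g \is e.-1.-homog.
Proof.
by move=> hg; apply: rpred_sum => i _; apply: rpredZ; apply: mderiv_homog.
Qed.

Lemma partialS_homog e S g : g \is e.-homog -> partialS S g \is (e - #|S|).-homog.
Proof.
move=> hg; have [k] := ubnP #|S|; elim: k S => // k IH S; rewrite ltnS => Sk.
have [->|[i iS]] := set_0Vmem S; first by rewrite cards0 subn0 partialS0.
rewrite -(setD1K iS) partialS_setU1 ?setD11 // cardsU1 setD11.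
rewrite add1n subnS; apply/mderiv_homog/IH.
by rewrite (leq_trans _ Sk) // [#|S|](cardsD1 i) iS.
Qed.

Lemma partialS_gt_eq0 e S g : g \is e.-homog -> (e < #|S|)%N -> partialS S g = 0.
Proof.
move=> hg eS; apply/mpolyP => m; rewrite mcoeff_mderivm mcoeff0.
rewrite (dhomog_nemf_coeff hg) ?mul0rn //= mdegD mdeg_mesym1; lia.
Qed.

Lemma partials_eq0 e g : g \is e.-homog -> (0 < e)%N ->
  (forall i, g^`M(i) = 0) -> g = 0.
Proof.
move=> hg e0 H; apply/mpolyP => m; rewrite mcoeff0; apply/eqP.
apply: contraT => gm; have md : mdeg m = e.
  by apply: (dhomog_mf hg); rewrite mcoeff_msupp.
have [i mi] : exists i, m i != 0%N.
  apply/existsP; apply: contraTT e0; rewrite negb_exists -md -eqn0Ngt mdeg_eq0.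
  move=> /forallP h; apply/eqP/mnmP => i; rewrite mnm0E; apply/eqP.
  by rewrite -[_ == _]negbK.
have := mcoeff_mderiv i g (m - U_(i))%MM; rewrite H mcoeff0 submK ?lep1mP //.
by move/esym/eqP; rewrite mulrn_eq0 (negPf gm) orbF.
Qed.

Lemma eval_homog1 x g : g \is 1.-homog -> g.@[x 0] = (dirD x g)@_0%MM.
Proof.
move=> /dhomogP hg; rewrite [in LHS](mpolyE g) [in RHS](mpolyE g).
rewrite [LHS]raddf_sum [dirD _ _]raddf_sum [RHS]raddf_sum /=; apply: eq_big_seq => m /hg.
move/eqP; rewrite mdeg_eq1 => /existsP[i /eqP ->].
rewrite mevalZ mevalXU linearZ /= mcoeffZ; congr (_ * _).
rewrite /dirD raddf_sum /= (bigD1 i) //= mcoeffZ mderivX mnm1E eqxx scale1r.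
have -> : (U_(i) - U_(i))%MM = 0%MM.
  by apply/mnmP => k; rewrite mnmBE mnm0E subnn.
rewrite mcoeffX eqxx mulr1 big1 ?addr0 // => j ji.
by rewrite mderivX mnm1E eq_sym (negPf ji) scale0r scaler0 mcoeff0.
Qed.

(** * Setting the variables of a face to zero *)

Definition rho S g : {mpoly R[n]} :=
  g \mPo [tuple (if i \in S then 0 else 'X_i) | i < n].

Lemma mcoeff_rho S g m :
  (rho S g)@_m = if [forall i in S, m i == 0%N] then g@_m else 0.
Proof.
rewrite /rho comp_mpolyEX raddf_sum /=.
have E k : ('X_[k] \mPo [tuple (if i \in S then 0 else 'X_i) | i < n])
    = if [forall i in S, k i == 0%N] then 'X_[k] else 0 :> {mpoly R[n]}.
  rewrite comp_mpolyX; case: ifPn => [/forall_inP H|].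
    rewrite [RHS]mpolyXE_id; apply: eq_bigr => i _; rewrite tnth_mktuple.
    by case: ifP => // /H/eqP ->; rewrite !expr0.
  case/forall_inPn => i iS ki; rewrite (bigD1 i) //= tnth_mktuple iS.
  by rewrite expr0n (negPf ki) mul0r.
under eq_bigr do rewrite mcoeffZ E.
case: ifPn => Hm.
  rewrite [in RHS](mpolyE g) raddf_sum /=; apply: eq_bigr => k _.
  rewrite mcoeffZ; case: ifPn => // Hk; rewrite mcoeff0 mcoeffX.
  by case: eqP Hk Hm => // -> /negPf ->.
rewrite big1 // => k _; case: ifPn => Hk; rewrite ?mcoeff0 ?mulr0 // mcoeffX.
by case: eqP Hk Hm => [-> -> //|]; rewrite mulr0.
Qed.

Fact rho_is_linear S : linear (rho S).
Proof. by move=> c g h; rewrite /rho linearP. Qed.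
HB.instance Definition _ S :=
  GRing.isLinear.Build R {mpoly R[n]} {mpoly R[n]} _ (rho S) (rho_is_linear S).

Lemma rho0 g : rho set0 g = g.
Proof.
apply/mpolyP => m; rewrite mcoeff_rho ifT //; apply/forall_inP => i.
by rewrite inE.
Qed.

Lemma rho_setU S T g : rho S (rho T g) = rho (S :|: T) g.
Proof.
apply/mpolyP => m; rewrite !mcoeff_rho; case: ifPn => HS; last first.
  rewrite ifF //; apply: contraNF HS => /forall_inP H; apply/forall_inP => i iS.
  by rewrite H // inE iS.
case: ifPn => HT; last first.
  rewrite ifF //; apply: contraNF HT => /forall_inP H; apply/forall_inP => i iS.
  by rewrite H // inE iS orbT.
rewrite ifT //; apply/forall_inP => i; rewrite inE.
by case/orP => [/(forall_inP HS)|/(forall_inP HT)].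
Qed.

Lemma rho_homog e S g : g \is e.-homog -> rho S g \is e.-homog.
Proof.
move=> /dhomogP hg; apply/dhomogP => m; rewrite mcoeff_msupp mcoeff_rho.
by case: ifP => [_ gm|]; [apply: hg; rewrite mcoeff_msupp | rewrite eqxx].
Qed.

Lemma mcoeff0_rho S g : (rho S g)@_0%MM = g@_0%MM.
Proof. by rewrite mcoeff_rho ifT //; apply/forall_inP => i _; rewrite mnm0E. Qed.

Lemma mderiv_rho_in S i g : i \in S -> (rho S g)^`M(i) = 0.
Proof.
move=> iS; apply/mpolyP => m; rewrite mcoeff_mderiv mcoeff_rho ifF ?mul0rn ?mcoeff0 //.
by apply/negP => /forall_inP/(_ i iS); rewrite mnmDE mnm1E eqxx addn1.
Qed.

Lemma mderiv_rho S i g : i \notin S -> (rho S g)^`M(i) = rho S g^`M(i).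
Proof.
move=> iS; apply/mpolyP => m; rewrite mcoeff_mderiv !mcoeff_rho mcoeff_mderiv.
rewrite [X in (if X then _ else 0) *+ _](_ : _ = [forall j in S, m j == 0%N]).
  by case: ifP => _ //; rewrite mul0rn.
apply: eq_forallb => j; case: (boolP (j \in S)) => //= jS; rewrite mnmDE mnm1E.
have -> : (i == j) = false by apply: contraNF iS => /eqP ->.
by rewrite addn0.
Qed.

Lemma dirD_rho S u g : (forall i, i \in S -> u 0 i = 0) ->
  dirD u (rho S g) = rho S (dirD u g).
Proof.
move=> uS; rewrite /dirD raddf_sum /=; apply: eq_bigr => i _.
case: (boolP (i \in S)) => iS; first by rewrite uS // !scale0r raddf0.
by rewrite linearZ /= mderiv_rho.
Qed.

Lemma iterD_rho S vs g : (forall u, u \in vs -> forall i, i \in S -> u 0 i = 0) ->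
  iterD vs (rho S g) = rho S (iterD vs g).
Proof.
elim: vs => //= u vs IH H; rewrite IH ?dirD_rho //; first by apply: H; rewrite mem_head.
by move=> v vvs; apply: H; rewrite in_cons vvs orbT.
Qed.

Lemma partialS_rho S T g : [disjoint T & S] ->
  partialS T (rho S g) = rho S (partialS T g).
Proof.
have [k] := ubnP #|T|; elim: k T => // k IH T; rewrite ltnS => Tk TS.
have [->|[i iT]] := set_0Vmem T; first by rewrite !partialS0.
rewrite -(setD1K iT) !partialS_setU1 ?setD11 // IH ?mderiv_rho //.
- by rewrite (disjointFr TS iT).
- by rewrite (leq_trans _ Tk) // [#|T|](cardsD1 i) iT.
- by apply: disjointWl TS; exact: subD1set.
Qed.

Lemma partialS_rho_meet S T i g : i \in S -> i \in T -> partialS T (rho S g) = 0.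
Proof.
move=> iS iT; rewrite (@partialS_sub [set i]) ?sub1set // partialS1.
by rewrite mderiv_rho_in // /partialS raddf0.
Qed.

Lemma linkpolyE S g : linkpoly g S = rho S (partialS S g).
Proof. by []. Qed.

(** Induction on the degree: derivatives along variables outside [S] commute with [rho S], hence
    vanish; for j in S, the relation D_l g = 0 expresses the derivative along j through those. *)
Lemma rho_eq0 e S g : g \is e.-homog ->
  (forall j, j \in S -> exists l : 'rV[R]_n,
     [/\ dirD l g = 0, l 0 j = 1 & forall k, k \in S -> k != j -> l 0 k = 0]) ->
  rho S g = 0 -> g = 0.
Proof.
elim: e g => [|e IH] g hg Hl g0.
  have gc : g = (g@_0)%:MP.
    apply/mpolyP => m; rewrite mcoeffC; case: eqP => [->|/eqP m0]; first by rewrite mulr1.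
    by rewrite mulr0 (dhomog_nemf_coeff hg) // mdeg_eq0.
  by rewrite gc -(mcoeff0_rho S) g0 mcoeff0 mpolyC0.
have dN i : i \notin S -> g^`M(i) = 0.
  move=> iS; apply: IH; first exact: mderiv_homog hg.
    move=> j jS; have [l [l1 l2 l3]] := Hl j jS; exists l; split => //.
    by rewrite dirD_mderiv l1 raddf0.
  by rewrite -mderiv_rho // g0 raddf0.
apply: (partials_eq0 hg) => // j; case: (boolP (j \in S)) => [jS|]; last exact: dN.
have [l [l1 l2 l3]] := Hl j jS; move: l1; rewrite /dirD (bigD1 j) //= l2 scale1r.
rewrite big1 ?addr0 // => k kj; case: (boolP (k \in S)) => [kS|/dN ->].
  by rewrite l3 // scale0r.
by rewrite scaler0.
Qed.

End DirectionalDerivatives.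

(** * Links of hereditary polynomials *)

Section HereditaryPolynomials.
Variables (R : realType) (n d : nat) (f : {mpoly R[n]}).
Hypotheses (f_homog : f \is d.-homog) (f_her : hereditary f).
Implicit Types (S T W : {set 'I_n}) (u v x y l : 'rV[R]_n) (i j : 'I_n).
Implicit Types us vs : seq 'rV[R]_n.

Local Notation G S := (partialS S f).
Local Notation skel := (skeleton (Delta f)).

Lemma in_Delta S : (S \in Delta f) = (G S != 0).
Proof. by rewrite inE. Qed.

Lemma Delta_sub S T : S \subset T -> T \in Delta f -> S \in Delta f.
Proof.
move=> ST; rewrite !in_Delta; apply: contra => /eqP S0.
by rewrite (partialS_sub _ ST) S0 /partialS raddf0.
Qed.

Lemma in_linkV S i : (i \in linkV f S) = (i \notin S) && (i |: S \in Delta f).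
Proof. by rewrite /linkV /vertices !inE disjoints1 setUC. Qed.

Lemma Delta_card S : S \in Delta f -> (#|S| <= d)%N.
Proof.
rewrite in_Delta leqNgt; apply: contra => dS.
by rewrite (partialS_gt_eq0 f_homog dS).
Qed.

Lemma skel_Delta S : S \in skel -> S \in Delta f.
Proof. by rewrite inE => /andP[]. Qed.

(** As [Delta f] is closed under subsets, a face properly contained in another can already be
    extended by one vertex. *)
Lemma in_skel S : (S \in skel) = (S \in Delta f) && (linkV f S != set0).
Proof.
rewrite inE; case: (boolP (S \in Delta f)) => //= SD; rewrite /facet SD /=.
apply/forall_inPn/set0Pn => [[T TD] | [ i ]]; last first.
  rewrite in_linkV => /andP[iS iD]; exists (i |: S) => //.
  by rewrite negbK properUr // sub1set.
rewrite negbK => /properP[ST [i iT iS]]; exists i; rewrite in_linkV iS /=.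
by apply: Delta_sub TD; rewrite subUset sub1set iT.
Qed.

Lemma skel_card S : S \in skel -> (#|S| < d)%N.
Proof.
rewrite in_skel => /andP[_ /set0Pn[ i ]]; rewrite in_linkV => /andP[iS].
by move=> /Delta_card; rewrite cardsU1 iS.
Qed.

Lemma mderiv_G S i : i \notin S -> (G S)^`M(i) = G (i |: S).
Proof. by move=> iS; rewrite partialS_setU1. Qed.

Lemma mderiv_G0 S i : i \notin S -> i \notin linkV f S -> (G S)^`M(i) = 0.
Proof.
by move=> iS; rewrite in_linkV iS /= in_Delta negbK mderiv_G // => /eqP.
Qed.

Lemma G_homog S : G S \is (d - #|S|).-homog.
Proof. exact: partialS_homog. Qed.

Lemma dirD_G_sub S T x y : S \subset T ->
  dirD x (G S) = dirD y (G S) -> dirD x (G T) = dirD y (G T).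
Proof.
by move=> ST e; rewrite !(partialS_sub _ ST) [LHS]dirD_partialS [RHS]dirD_partialS e.
Qed.

Lemma dirD_G0_sub S T l : S \subset T -> dirD l (G S) = 0 -> dirD l (G T) = 0.
Proof.
by move=> ST e; rewrite (partialS_sub _ ST) dirD_partialS e /partialS raddf0.
Qed.

(** Heredity supplies the vectors [l] of [rho_eq0]. This injectivity of t_S = 0 lets derivatives of
    f replace the polynomials f^S. *)
Lemma skel_rho_eq0 S e g : S \in skel -> g \is e.-homog ->
  (forall l, dirD l f = 0 -> dirD l g = 0) -> rho S g = 0 -> g = 0.
Proof.
move=> SK hg Hl; apply: (rho_eq0 hg) => j jS.
have [l [_ lf] lc] := f_her SK (fun i => (i == j)%:R).
exists l; split; [exact: Hl | by rewrite lc // eqxx |].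
by move=> k kS kj; rewrite lc // (negPf kj).
Qed.

Definition restr W x : 'rV[R]_n := \row_j (if j \in W then x 0 j else 0).

Lemma restr_supported W x : supported W (restr W x).
Proof. by move=> i iW; rewrite mxE (negPf iW). Qed.

Lemma dirD_restr S W x : linkV f S \subset W -> (forall j, j \in S -> x 0 j = 0) ->
  dirD (restr W x) (G S) = dirD x (G S).
Proof.
move=> SW xS; apply: dirD_eq => j; rewrite mxE; case: ifPn => jW; first by left.
case: (boolP (j \in S)) => jS; first by left; rewrite xS.
by right; apply: mderiv_G0 => //; apply: contra jW; apply: (subsetP SW).
Qed.

(** Stands in for pi_S: heredity gives a vector of L_f agreeing with [x] on [S]; once it is
    subtracted, only the link vertices matter. *)
Lemma skel_proj S x : S \in skel ->
  exists2 y, supported (linkV f S) y & dirD x (G S) = dirD y (G S).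
Proof.
move=> SK; have [l [_ lf] lc] := f_her SK (fun i => x 0 i).
exists (restr (linkV f S) (x - l)); first exact: restr_supported.
rewrite dirD_restr // => [|j jS]; last by rewrite !mxE lc // subrr.
by rewrite dirDBl [dirD l _]dirD_partialS lf /partialS raddf0 subr0.
Qed.

Lemma Delta_linkpoly S : S \in skel -> Delta (linkpoly f S) = link (Delta f) S.
Proof.
move=> SK; apply/setP => T; rewrite in_set [in RHS]inE linkpolyE.
case: (boolP [disjoint T & S]) => TS /=.
  rewrite in_Delta partialS_setU // partialS_rho // -partialS_setU //.
  congr (~~ _); apply/eqP/eqP => [|->]; last by rewrite raddf0.
  apply: (skel_rho_eq0 SK (G_homog _)) => l lf.
  by rewrite dirD_partialS lf /partialS raddf0.
have [i /andP[iS iT]] : exists i, (i \in S) && (i \in T).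
  apply/existsP; apply: contraR TS; rewrite negb_exists => /forallP H.
  by apply/pred0P => i; have := H i; rewrite andbC => /negPf.
by rewrite (partialS_rho_meet _ iS iT) eqxx.
Qed.

Lemma Delta_linkpoly1 S i : S \in skel ->
  ([set i] \in Delta (linkpoly f S)) = (i \in linkV f S).
Proof. by move=> SK; rewrite Delta_linkpoly // [in RHS]inE. Qed.

Lemma linkV_linkpoly S i : S \in skel -> i \in linkV f S ->
  linkV (linkpoly f S) [set i] = linkV f (i |: S).
Proof.
move=> SK; rewrite in_linkV => /andP[iS iD]; apply/setP => j.
have -> : (j \in linkV (linkpoly f S) [set i]) = [disjoint [set j] & [set i]] &&
    ([set i] :|: [set j] \in Delta (linkpoly f S)).
  by rewrite /linkV /vertices inE inE.
rewrite in_linkV Delta_linkpoly // [_ \in link _ _]inE in_setU1 negb_or.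
rewrite disjoints1 in_set1 -setI_eq0 setIUl setU_eq0 !setI_eq0 !disjoints1 iS /=.
rewrite -andbA; congr (_ && (_ && (_ \in Delta f))).
by apply/setP => k; rewrite !inE orbC -!orbA [(k == i) || _]orbCA.
Qed.

Lemma linkpoly_linkpoly S i : i \notin S ->
  linkpoly (linkpoly f S) [set i] = linkpoly f (i |: S).
Proof.
move=> iS; rewrite !linkpolyE partialS_rho ?disjoints1 // rho_setU.
by rewrite -partialS_setU ?disjoints1 // [S :|: _]setUC.
Qed.

Lemma dirD_linkpoly S l : S \in skel -> (forall j, j \in S -> l 0 j = 0) ->
  dirD l (linkpoly f S) = 0 <-> dirD l (G S) = 0.
Proof.
move=> SK lS; rewrite linkpolyE dirD_rho //; split => [|->]; last by rewrite raddf0.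
apply: (skel_rho_eq0 SK (dirD_homog _ (G_homog _))) => u uf.
by rewrite dirDC [dirD u _]dirD_partialS uf /partialS !raddf0.
Qed.

(** The vectors l^(i) for f^S and its face {i}, seen in R^V: vanishing on [S] replaces the support
    condition. *)
Definition transversal S i l : Prop :=
  [/\ dirD l (G S) = 0, l 0 i = 1 & forall j, j \in S -> l 0 j = 0].

(** A multiple of [l] does not affect derivatives of [G (i |: S)], and the coordinates dropped by
    [restr] are zero or meet a vanishing partial derivative. Projections thus disappear from the
    recursion. *)
Lemma dirD_pi S i y l : i \notin S -> (forall j, j \in S -> y 0 j = 0) ->
  transversal S i l ->
  dirD (restr (linkV f (i |: S)) (y - y 0 i *: l)) (G (i |: S)) =
  dirD y (G (i |: S)).
Proof.
move=> iS yS [lG li lS]; rewrite dirD_restr // => [|j].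
  by rewrite dirDBl dirDZl (dirD_G0_sub (subsetUr _ _) lG) scaler0 subr0.
rewrite in_setU1 => /orP[/eqP ->|jS]; rewrite !mxE; first by rewrite li mulr1 subrr.
by rewrite lS // (yS j) // mulr0 subrr.
Qed.

(** Were [i |: S] a facet, the partial derivatives of [G (i |: S)] outside it would vanish; then [l]
    kills the one along [i], heredity at [S] those along [S], and a polynomial of positive degree
    would be zero. *)
Lemma transversal_skel S i l : S \in skel -> i \in linkV f S ->
  (#|S|.+1 < d)%N -> transversal S i l -> i |: S \in skel.
Proof.
move=> SK; rewrite in_linkV => /andP[iS iD] Sd [lG li lS].
rewrite in_skel iD /=; apply: contraL iD => /eqP V0; rewrite in_Delta negbK.
have dN j : j \notin i |: S -> (G (i |: S))^`M(j) = 0.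
  by move=> jS; apply: mderiv_G0; rewrite // V0 inE.
have di : (G (i |: S))^`M(i) = 0.
  have := dirD_G0_sub (subsetUr [set i] S) lG.
  rewrite /dirD (bigD1 i) //= li scale1r big1 ?addr0 // => j ji.
  case: (boolP (j \in S)) => jS; first by rewrite lS // scale0r.
  by rewrite dN ?scaler0 // !inE negb_or ji.
apply/eqP; apply: (partials_eq0 (G_homog _)) => [|j].
  by rewrite cardsU1 iS subn_gt0.
case: (boolP (j \in i |: S)) => [|/dN //]; rewrite in_setU1 => /orP[/eqP -> //|jS].
have [l' [_ lf] lc] := f_her SK (fun k => (k == j)%:R).
have : dirD l' (G (i |: S)) = 0 by rewrite dirD_partialS lf /partialS raddf0.
rewrite /dirD (bigD1 j) //= lc // eqxx scale1r big1 ?addr0 // => k kj.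
case: (boolP (k \in S)) => kS; first by rewrite lc // (negPf kj) scale0r.
case: (eqVneq k i) => [->|ki]; first by rewrite di scaler0.
by rewrite dN ?scaler0 // !inE negb_or ki.
Qed.

(* The cone of f^S, unfolded over all faces above S and described by the
   derivatives of f themselves: no projection is needed. *)
Definition flat S x : Prop :=
  forall T, T \in Delta f -> S \subset T ->
    ((#|T|.+1 < d)%N ->
       (exists2 p, posorthant (linkV f T) p & dirD x (G T) = dirD p (G T)) /\
       (forall i, i \in linkV f T -> exists l, transversal T i l)) /\
    (#|T|.+1 = d -> 0 < (dirD x (G T))@_0%MM).

Lemma flat_sub S T x : S \subset T -> flat S x -> flat T x.
Proof. by move=> ST H U UD TU; apply: H => //; apply: subset_trans TU. Qed.

Lemma flat_sim S x y : dirD x (G S) = dirD y (G S) -> flat S x -> flat S y.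
Proof.
move=> e H T TD ST; have := H T TD ST; rewrite (dirD_G_sub ST e).
by case=> H1 H2; split.
Qed.

Lemma linkpoly_homog1 S : (#|S|.+1 = d)%N -> linkpoly f S \is 1.-homog.
Proof.
move=> Sd; rewrite linkpolyE; apply: rho_homog.
by have := G_homog S; rewrite -Sd subSnn.
Qed.

Lemma hcone_supported k W g y : hcone k W g y -> supported W y.
Proof.
case: k => [|[|k]] //=; first by case.
by case=> [[p [l [[ps _] [ls _] ->]]] _] i iW; rewrite mxE ps ?ls // addr0.
Qed.

(** [W] is general because the cone of f lives in all of R^V while the recursive cones live on link
    vertices; [x] is any vector with the same derivative as [y]. *)
Lemma hcone_flat k S W x y : S \in skel -> (#|S| + k.+1 = d)%N ->
  linkV f S \subset W -> [disjoint W & S] ->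
  hcone k.+1 W (linkpoly f S) y -> dirD x (G S) = dirD y (G S) -> flat S x.
Proof.
elim: k S W x y => [|k IH] S W x y SK Sd SW WS.
  move=> [ys y0] xy T TD ST; have Td := Delta_card TD.
  have cST := subset_leq_card ST.
  split => Tc; first lia.
  have ET : S = T by apply/eqP; rewrite eqEcard ST; lia.
  rewrite -ET xy; move: y0; rewrite eval_homog1; last by apply: linkpoly_homog1; lia.
  rewrite linkpolyE dirD_rho ?mcoeff0_rho // => j jS.
  by apply: ys; apply: contraTN jS => jW; rewrite (disjointFr WS jW).
have Sd1 : (#|S|.+1 < d)%N by lia.
have Sd2 : (#|S|.+1 + k.+1 = d)%N by lia.
move=> yc; have ysup := hcone_supported yc.
have offS z : supported W z -> forall j, j \in S -> z 0 j = 0.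
  by move=> zs j jS; apply: zs; apply: contraTN jS => jW; rewrite (disjointFr WS jW).
case: yc => [[p [l [[ps p0] [ls lf] yE]]] ypi] xy.
have tr i : i \in linkV f S -> exists l, transversal S i l /\
    hcone k.+1 (linkV f (i |: S)) (linkpoly f (i |: S))
      (restr (linkV f (i |: S)) (y - y 0 i *: l)).
  move=> iV; have iS : i \notin S by move: iV; rewrite in_linkV => /andP[].
  have iD : [set i] \in Delta (linkpoly f S) by rewrite Delta_linkpoly1.
  case: (ypi i iD) => y' [l' [/(_ i (set11 i)) [[l's l'f] l'i _] ->]].
  rewrite linkV_linkpoly // linkpoly_linkpoly // big_set1 => yc.
  exists (l' i); split => //; split => //; last exact: offS.
  by apply/dirD_linkpoly => //; exact: offS.
(* For T = S the conditions come from the outermost clause of the cone; a larger T lies above some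
   [i |: S], where the induction applies once [transversal_skel] puts it in the skeleton. *)
move=> T TD ST; have [ET|nST] := eqVneq S T.
  subst T; split => Tc; last lia.
  split; last by move=> i /tr[l' []]; exists l'.
  exists (restr (linkV f S) p).
    split; first exact: restr_supported.
    by move=> i iV; rewrite mxE iV p0 // (subsetP SW).
  rewrite xy yE dirDDl dirD_restr //; last exact: offS.
  have /dirD_linkpoly -> // := lf; first by rewrite addr0.
  exact: offS.
have [i iT iS] : exists2 i, i \in T & i \notin S.
  have /properP[_ [i iT iS]] : S \proper T by rewrite properEneq nST.
  by exists i.
have iTS : i |: S \subset T by rewrite subUset sub1set iT.
have iV : i \in linkV f S by rewrite in_linkV iS (Delta_sub iTS).
have [l' [trl yc]] := tr i iV.
have SiK : i |: S \in skel by exact: (transversal_skel SK iV Sd1 trl).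
apply: (IH (i |: S) (linkV f (i |: S)) x _ SiK _ _ _ yc) => //.
- by rewrite cardsU1 iS add1n.
- apply/pred0P => j /=; rewrite in_linkV; case: (j \in i |: S) => //=.
  by rewrite andbF.
- rewrite dirD_pi //; last exact: offS.
  by apply: dirD_G_sub xy; exact: subsetUr.
Qed.

(** * Consequences of a nonempty cone *)

Hypotheses (f_neq0 : f != 0) (d_gt1 : (1 < d)%N).
Variable x0 : 'rV[R]_n.
Hypothesis x0_cone : hcone d [set: 'I_n] f x0.

Lemma set0_skel : set0 \in skel.
Proof.
rewrite in_skel in_Delta partialS0 f_neq0 /=; apply: contraNneq f_neq0 => V0.
rewrite (partials_eq0 f_homog) ?(ltnW d_gt1) // => i.
by rewrite -[f]partialS0; apply: mderiv_G0; rewrite ?V0 inE.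
Qed.

Lemma flat_x0 : flat set0 x0.
Proof.
have dE : d = d.-1.+1 by rewrite prednK // ltnW.
apply: (@hcone_flat d.-1 set0 [set: 'I_n] x0 x0) => //.
- exact: set0_skel.
- by rewrite cards0 -dE.
- by rewrite -setI_eq0 setI0.
- by rewrite -dE linkpolyE rho0 partialS0.
Qed.

(** All facets of [Delta f] have size d: [flat_x0] gives transversals over every small enough face,
    so [transversal_skel] passes from [S :\ i] to [S]. *)
Lemma in_skel_card S : (S \in skel) = (S \in Delta f) && (#|S| < d)%N.
Proof.
apply/idP/andP => [SK|[]]; first by rewrite (skel_Delta SK) (skel_card SK).
have [k] := ubnP #|S|; elim: k S => // k IH S; rewrite ltnS => Sk SD Sd.
have [->|[i iS]] := set_0Vmem S; first exact: set0_skel.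
have cS : #|S| = #|S :\ i|.+1 by rewrite [LHS](cardsD1 i) iS.
have S'D : S :\ i \in Delta f by apply: Delta_sub SD; exact: subD1set.
have S'K : S :\ i \in skel by apply: IH => //; lia.
have iV : i \in linkV f (S :\ i) by rewrite in_linkV setD11 setD1K.
have [F1 _] := flat_x0 S'D (sub0set _).
have [|_ /(_ i iV) [l tl]] := F1; first by rewrite -cS.
by rewrite -(setD1K iS); apply: transversal_skel tl => //; rewrite -cS.
Qed.

Lemma setU1_skel S i : i \in linkV f S -> (#|S|.+1 < d)%N -> i |: S \in skel.
Proof.
rewrite in_linkV => /andP[iS iD] Sd.
by rewrite in_skel_card iD cardsU1 iS.
Qed.

Lemma supported_linkV S y : supported (linkV f S) y -> forall j, j \in S -> y 0 j = 0.
Proof. by move=> ys j jS; apply: ys; rewrite in_linkV jS. Qed.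

(** Converse of [hcone_flat]: since [i |: S] lies in the skeleton, heredity there yields a vector
    defining the projection, whose image is flat because it has the same derivative. *)
Lemma flat_hcone k S y : S \in skel -> (#|S| + k.+1 = d)%N ->
  supported (linkV f S) y -> flat S y -> hcone k.+1 (linkV f S) (linkpoly f S) y.
Proof.
elim: k S y => [|k IH] S y SK Sd ys yF; have SD := skel_Delta SK;
  have [F1 F2] := yF S SD (subxx _); have y0 := supported_linkV ys.
  split => //; rewrite eval_homog1; last by apply: linkpoly_homog1; lia.
  by rewrite linkpolyE dirD_rho // mcoeff0_rho; apply: F2; lia.
have [[p [ps p0] yp] _] := F1 ltac:(lia); split.
  exists p, (y - p); split => //; last by rewrite addrC subrK.
  have lS : supported (linkV f S) (y - p) by move=> i iV; rewrite !mxE ys ?ps // subrr.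
  split => //; apply/dirD_linkpoly => //; first exact: supported_linkV.
  by rewrite dirDBl yp subrr.
move=> i; rewrite Delta_linkpoly1 // => iV.
have iS : i \notin S by move: iV; rewrite in_linkV => /andP[].
have SiK : i |: S \in skel by apply: setU1_skel => //; lia.
have [l [_ lf] lc] := f_her SiK (fun k => (k == i)%:R).
have lS j : j \in S -> l 0 j = 0.
  move=> jS; rewrite lc ?in_setU1 ?jS ?orbT //.
  by have -> : (j == i) = false by apply: contraTF jS => /eqP ->.
pose l' := restr (linkV f S) l.
have tl : transversal S i l'.
  split; last by apply: supported_linkV; exact: restr_supported.
    by rewrite dirD_restr // dirD_partialS lf /partialS raddf0.
  by rewrite mxE iV lc ?eqxx // setU11.
have [tl1 tl2 tl3] := tl.
exists (restr (linkV f (i |: S)) (y - y 0 i *: l')).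
  exists (fun _ => l'); split.
    move=> j /set1P ->; split => //; first split; first exact: restr_supported.
      by apply/dirD_linkpoly.
    by move=> k0 /set1P ->; rewrite eqxx.
  by rewrite linkV_linkpoly // big_set1.
rewrite linkV_linkpoly // linkpoly_linkpoly //; apply: IH => //.
- by rewrite cardsU1 iS; lia.
- exact: restr_supported.
- apply: (@flat_sim _ y); first by rewrite dirD_pi.
  by apply: flat_sub yF; exact: subsetUr.
Qed.

Lemma hcone_linkV_flat S y : S \in skel ->
  hcone (d - #|S|) (linkV f S) (linkpoly f S) y -> flat S y.
Proof.
move=> SK; have Sd := skel_card SK.
have -> : (d - #|S| = (d - #|S|).-1.+1)%N by lia.
move=> yc; apply: (hcone_flat SK _ _ _ yc) => //; first lia.
by apply/pred0P => j /=; rewrite in_linkV; case: (j \in S); rewrite ?andbF.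
Qed.

(** The point [x0] projects into the cone of every such f^S, as flatness passes to larger faces and
    depends only on the derivative. *)
Lemma hcone_nonempty S : S \in skel ->
  exists y, hcone (d - #|S|) (linkV f S) (linkpoly f S) y.
Proof.
move=> SK; have Sd := skel_card SK.
have [y ys e] := skel_proj x0 SK; exists y.
have -> : (d - #|S| = (d - #|S|).-1.+1)%N by lia.
apply: flat_hcone => //; first lia.
by apply: flat_sim e _; apply: flat_sub flat_x0; exact: sub0set.
Qed.

(** * Positivity of mixed derivatives *)

Lemma mixed_expand S us p : supported (linkV f S) p ->
  (iterD us (dirD p (G S)))@_0%MM =
  \sum_(i in linkV f S) p 0 i * (iterD us (G (i |: S)))@_0%MM.
Proof.
move=> ps; rewrite /dirD !raddf_sum /= [RHS]big_mkcond /=; apply: eq_bigr => i _.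
rewrite linearZ /= mcoeffZ; case: ifPn => iV; last by rewrite ps // mul0r.
by rewrite mderiv_G //; move: iV; rewrite in_linkV => /andP[].
Qed.

(** Replacing the first vector by its positive representative [p] gives a positive combination, over
    the nonempty link, of mixed derivatives at the faces [i |: S]. The last vector falls under the
    degree 1 clause of [flat]. *)
Lemma mixed_gt0 vs S : S \in skel -> (#|S| + size vs = d)%N ->
  (forall v, v \in vs -> flat S v) -> 0 < (iterD vs (G S))@_0%MM.
Proof.
elim: vs S => [|v vs IH] S SK; first by have := skel_card SK; rewrite addn0; lia.
move=> /= Sd vF; have SD := skel_Delta SK.
have [F1 F2] := vF v (mem_head _ _) S SD (subxx _).
case: vs IH Sd vF F1 F2 => [|w vs] IH Sd vF F1 F2; first by apply: F2; rewrite -Sd addn1.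
have {F1 F2}[|[p [ps p0] vp] _] := F1; first by rewrite -Sd /=; lia.
rewrite dirD_iterD vp mixed_expand //.
have V0 : linkV f S != set0 by move: SK; rewrite in_skel => /andP[].
have [i iV] := set0Pn _ V0.
have pos j : j \in linkV f S -> 0 < p 0 j * (iterD (w :: vs) (G (j |: S)))@_0%MM.
  move=> jV; rewrite mulr_gt0 ?p0 //; apply: IH.
  - by apply: setU1_skel => //; rewrite -Sd /=; lia.
  - by move: jV; rewrite in_linkV => /andP[jS _]; rewrite cardsU1 jS -Sd /=; lia.
  - move=> u uvs; apply: (@flat_sub S); first exact: subsetUr.
    by apply: vF; rewrite in_cons uvs orbT.
by apply: (sumr_gt0_at (i0 := i)) => // [j /pos/ltW|]; [|exact: pos].
Qed.

(** Taken on all of R^V, so that vectors with the same derivative can be exchanged. *)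
Definition qf S us x y : R := (iterD [:: x, y & us] (G S))@_0%MM.

Lemma qfC S us x y : qf S us x y = qf S us y x.
Proof. by rewrite /qf /= dirDC. Qed.

Lemma qfE S us x y : qf S us x y = (iterD (y :: us) (dirD x (G S)))@_0%MM.
Proof. by rewrite /qf -dirD_iterD. Qed.

Lemma qf_sim S us x x' y : dirD x (G S) = dirD x' (G S) -> qf S us x y = qf S us x' y.
Proof. by rewrite !qfE => ->. Qed.

(** Only nonnegativity and one positive entry are asked of [r], to cover restrictions of a positive
    vector to part of the vertices. *)
Lemma qf_gt0 S us r y i : S \in skel -> (#|S| + (size us).+2 = d)%N ->
  (forall v, v \in y :: us -> flat S v) -> supported (linkV f S) r ->
  (forall j, 0 <= r 0 j) -> i \in linkV f S -> 0 < r 0 i -> 0 < qf S us r y.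
Proof.
move=> SK Sd vF rs r0 iV ri; rewrite qfE mixed_expand //.
have pos j : j \in linkV f S -> 0 < (iterD (y :: us) (G (j |: S)))@_0%MM.
  move=> jV; apply: mixed_gt0.
  - by apply: setU1_skel => //; lia.
  - by move: jV; rewrite in_linkV => /andP[jS _]; rewrite cardsU1 jS -Sd add1n addSn !addnS.
  - by move=> u uvs; apply: (@flat_sub S); [exact: subsetUr | exact: vF].
apply: (sumr_gt0_at (i0 := i)) => // [j jV|].
  by rewrite mulr_ge0 // ltW // pos.
by rewrite mulr_gt0 // pos.
Qed.

(** * Hessians in coordinates *)

Section Coordinates.
Variable W : {set 'I_n}.

Definition embed (x : 'rV[R]_#|W|) : 'rV[R]_n :=
  \sum_k x 0 k *: unitv R (enum_val k).

Definition coords v : 'rV[R]_#|W| := \row_k v 0 (enum_val k).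

Lemma embed_coords v : supported W v -> embed (coords v) = v.
Proof.
move=> vs; apply/rowP => i; rewrite /embed.
under eq_bigr do rewrite mxE.
rewrite -(big_enum_val (fun j => v 0 j *: unitv R j)) summxE.
have [iW|iW] := boolP (i \in W); last first.
  rewrite vs // big1 // => j jW; rewrite !mxE eqxx /=.
  have -> : (i == j) = false by apply: contraNF iW => /eqP ->.
  by rewrite mulr0.
rewrite (bigD1 i) //= !mxE !eqxx mulr1 big1 ?addr0 // => j /andP[_ ji].
by rewrite !mxE eqxx /= eq_sym (negPf ji) mulr0.
Qed.

Lemma bform_hessian g (x y : 'rV[R]_#|W|) :
  bform (hessian W g) x y = (dirD (embed x) (dirD (embed y) g))@_0%MM.
Proof.
rewrite bformE /embed dirD_suml raddf_sum /=; apply: eq_bigr => i _.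
rewrite dirDZl mcoeffZ dirD_suml (raddf_sum (dirD (unitv R _))).
rewrite (raddf_sum (mcoeff 0%MM)) /= mulr_sumr; apply: eq_bigr => j _.
rewrite dirDZl linearZ /= mcoeffZ mxE !dirD_unitv mderiv_comm.
by rewrite mulrCA mulrA mulrC mulrA.
Qed.

Lemma hessian_sym (g : {mpoly R[n]}) : (hessian W g)^T = hessian W g.
Proof. by apply/matrixP => i j; rewrite !mxE mderiv_comm. Qed.

Lemma mulmx_hessian g (x : 'rV[R]_#|W|) k :
  (x *m hessian W g) 0 k = (dirD (embed x) (dirD (unitv R (enum_val k)) g))@_0%MM.
Proof.
rewrite mxE /embed dirD_suml raddf_sum /=; apply: eq_bigr => i _.
by rewrite dirDZl mcoeffZ mxE !dirD_unitv mderiv_comm.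
Qed.

End Coordinates.

Lemma hessian_linkpoly S us : (forall u, u \in us -> supported (linkV f S) u) ->
  hessian (linkV f S) (iterD us (linkpoly f S)) = hessian (linkV f S) (iterD us (G S)).
Proof.
move=> us_s; apply/matrixP => i j; rewrite !mxE linkpolyE iterD_rho; last first.
  by move=> u /us_s; exact: supported_linkV.
have nS (k : 'I_#|linkV f S|) : enum_val k \notin S.
  by have := enum_valP k; rewrite in_linkV => /andP[].
by rewrite !mderiv_rho // mcoeff0_rho.
Qed.

Lemma bform_qf S us (x y : 'rV[R]_#|linkV f S|) :
  bform (hessian (linkV f S) (iterD us (G S))) x y = qf S us (embed x) (embed y).
Proof. by rewrite bform_hessian. Qed.

(** By [skel_proj], each vector of R^V can be replaced by one supported on the link without changing
    the form. *)
Lemma lorentz_hessian S us : S \in skel ->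
  lorentz_form (bform (hessian (linkV f S) (iterD us (G S)))) <->
  lorentz_form (qf S us).
Proof.
move=> SK; split => L x w ww; last by move: ww; rewrite !bform_qf; exact: L.
have [x' xs xx'] := skel_proj x SK; have [w' ws ww'] := skel_proj w SK.
have qE a b a' b' : dirD a (G S) = dirD a' (G S) -> dirD b (G S) = dirD b' (G S) ->
    qf S us a b = qf S us a' b'.
  by move=> e1 e2; rewrite (qf_sim _ _ e1) qfC (qf_sim _ _ e2) qfC.
rewrite (qE _ _ _ _ xx' xx') (qE _ _ _ _ xx' ww') (qE _ _ _ _ ww' ww').
have := L (coords (linkV f S) x') (coords (linkV f S) w').
rewrite !bform_qf !embed_coords //; apply.
by rewrite -(qE _ _ _ _ ww' ww').
Qed.

(** * Rank and purity of the skeleton *)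

Lemma cpx_rank_skel : cpx_rank skel = d.-1.
Proof.
(* Faces are grown from the empty one by adding link vertices; sizes up to d - 1 occur, and
   [cpx_rank] counts size rather than dimension. *)
have H k : (k < d)%N -> exists2 S, S \in skel & #|S| = k.
  elim: k => [|k IH] kd; first by exists set0; rewrite ?set0_skel ?cards0.
  have [S SK Sk] := IH (ltnW kd).
  have /set0Pn[i iV] : linkV f S != set0 by move: SK; rewrite in_skel => /andP[].
  exists (i |: S); first by apply: setU1_skel; rewrite ?Sk.
  by move: iV; rewrite in_linkV => /andP[iS _]; rewrite cardsU1 iS Sk.
apply/eqP; rewrite eqn_leq; apply/andP; split.
  by apply/bigmax_leqP => S /skel_card; lia.
have [|S SK <-] := H d.-1; first lia.
exact: leq_bigmax_cond.
Qed.

Lemma pure_skel : pure skel.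
Proof.
move=> S /andP[SK /forall_inP Smax]; rewrite cpx_rank_skel.
have Sd := skel_card SK; apply/eqP; rewrite eqn_leq; apply/andP; split; first lia.
rewrite leqNgt; apply/negP => Sd'.
have /set0Pn[i iV] : linkV f S != set0 by move: SK; rewrite in_skel => /andP[].
have := Smax _ (setU1_skel iV ltac:(lia)).
by move: iV; rewrite in_linkV => /andP[iS _]; rewrite properUr // sub1set.
Qed.

(** * From (C) and (Q) to the Lorentzian property *)

Lemma in_link_skel S T : (T \in link skel S) = [disjoint T & S] && (S :|: T \in skel).
Proof. by rewrite inE. Qed.

Lemma vertices_link_skel S i : (#|S|.+1 < d)%N ->
  (i \in vertices (link skel S)) = (i \in linkV f S).
Proof.
move=> Sd; rewrite inE in_link_skel disjoints1 setUC in_linkV.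
by case: (boolP (i \in S)) => //= iS; rewrite in_skel_card cardsU1 iS Sd andbT.
Qed.

(** [trickling_down] applied to the Hessian [H], with [p] the positive representative of [v]. *)
Lemma lorentz_step S v us : S \in skel -> (#|S| + (size us).+3 = d)%N ->
  connected (link skel S) -> (forall u, u \in v :: us -> flat S u) ->
  (forall i, i \in linkV f S -> lorentz_form (qf (i |: S) us)) ->
  lorentz_form (qf S (v :: us)).
Proof.
move=> SK Sd Sc uF IH; have SD := skel_Delta SK.
have [F1 _] := uF v (mem_head _ _) S SD (subxx _).
have [|[p [ps p0] vp] _] := F1; first lia.
pose V := linkV f S; pose H := hessian V (iterD (v :: us) (G S)).
pose P := coords V p; have PE : embed P = p by exact: embed_coords.
have VS (k : 'I_#|V|) : enum_val k \in linkV f S by exact: enum_valP.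
have VN (k : 'I_#|V|) : enum_val k \notin S by have := VS k; rewrite in_linkV => /andP[].
have uFi i u : u \in v :: us -> flat (i |: S) u.
  by move=> /uF; apply: flat_sub; exact: subsetUr.
have SiK i : i \in linkV f S -> i |: S \in skel by move=> iV; apply: setU1_skel => //; lia.
(* A row of [H] differentiates along one link vertex, so the coordinates of x H are pairings with
   [v] in the forms of larger faces. *)
have xH (x : 'rV[R]_#|V|) k : (x *m H) 0 k = qf (enum_val k |: S) us (embed x) v.
  rewrite /H mulmx_hessian dirD_unitv -iterD_mderiv mderiv_G //.
have hpos (k : 'I_#|V|) : 0 < qf (enum_val k |: S) us v v.
  apply: mixed_gt0; first by apply: SiK; exact: VS.
    by rewrite cardsU1 VN -Sd add1n addSn /= !addnS.
  by move=> u; rewrite in_cons => /orP[/eqP ->|]; apply: uFi; rewrite mem_head.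
have hE (k : 'I_#|V|) : (P *m H) 0 k = qf (enum_val k |: S) us v v.
  rewrite xH PE; apply: qf_sim; apply: dirD_G_sub (esym vp); exact: subsetUr.
have HE (k k' : 'I_#|V|) : k != k' -> H k k' =
    (iterD (v :: us) (G (enum_val k' |: (enum_val k |: S))))@_0%MM.
  move=> kk; rewrite mxE -!iterD_mderiv !mderiv_G //.
  rewrite in_setU1 negb_or VN andbT; apply: contra kk => /eqP/enum_val_inj -> //.
have Hpos (k k' : 'I_#|V|) : k != k' ->
    enum_val k' |: (enum_val k |: S) \in Delta f -> 0 < H k k'.
  move=> kk D2; rewrite HE //.
  have c2 : #|enum_val k' |: (enum_val k |: S)| = #|S|.+2.
    rewrite cardsU1 cardsU1 VN in_setU1 negb_or VN andbT.
    by have -> : enum_val k' != enum_val k by rewrite (inj_eq enum_val_inj) eq_sym.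
  apply: mixed_gt0; first by rewrite in_skel_card D2 c2; lia.
    by rewrite c2 -Sd /= !addSn !addnS.
  by move=> u uus; apply: (flat_sub _ (uF u uus)); rewrite setUA subsetUr.
apply/lorentz_hessian => //; apply: (@hyperplane_lorentz _ _ _ P).
  exact: hessian_sym.
apply: trickling_down.
- exact: hessian_sym.
- by move=> k; rewrite mxE; apply: p0.
- by move=> k; rewrite hE.
- move=> k k' kk; case: (boolP (enum_val k' |: (enum_val k |: S) \in Delta f)) => D2.
    exact/ltW/Hpos.
  by rewrite HE //; move: D2; rewrite in_Delta negbK => /eqP ->; rewrite !raddf0.
(* [z] is carried along a path in the link, whose edges between distinct vertices give positive
   entries of [H]. *)
- move=> z zH k k'.
  have /connectP[s sp sl] : connect (fun a b => [set a; b] \in link skel S)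
      (enum_val k) (enum_val k').
    by apply: Sc; rewrite vertices_link_skel //; lia.
  elim: s k sp sl => [|c s IHs] k /=; first by move=> _ /enum_val_inj ->.
  move=> /andP[kc sp] sl.
  move: kc; rewrite in_link_skel => /andP[dis /skel_Delta kcD].
  have cS : c \notin S by rewrite (disjointFr dis) // set22.
  have cV : c \in linkV f S.
    rewrite in_linkV cS; apply: Delta_sub kcD.
    by rewrite subUset sub1set !inE eqxx !orbT subsetUl.
  pose k1 := enum_rank_in cV c; have k1E : enum_val k1 = c by rewrite enum_rankK_in.
  rewrite -k1E in sp sl; rewrite -(IHs _ sp sl).
  have [-> //|kk] := eqVneq k k1; apply: zH => //; apply: Hpos => //.
  rewrite k1E (_ : c |: _ = S :|: [set enum_val k; c]) //.
  by rewrite [RHS]setUC -setUA setUCA.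
(* D_v is expanded along [p], and reverse Cauchy-Schwarz against [v] at each face [i |: S] bounds
   the summands. *)
- move=> x; rewrite bform_qf.
  have -> : qf S (v :: us) (embed x) (embed x) =
      (iterD [:: embed x, embed x & us] (dirD v (G S)))@_0%MM.
    by rewrite -dirD_iterD /qf /= !(dirDC v).
  rewrite vp mixed_expand // -/V.
  rewrite (big_enum_val (fun i => p 0 i * qf (i |: S) us (embed x) (embed x))).
  apply: ler_sum => k _; rewrite hE xH mxE -mulrA ler_pM2l ?p0 //.
  by rewrite ler_pdivlMr //; apply: IH.
Qed.

(** Induction on [us]: the empty list means |S| = d - 2, which is (Q); otherwise |S| + 2 <= d - 1,
    the rank of the skeleton, and (C) applies. *)
Lemma lorentz_all us S :
  H_connected skel ->
  (forall S, S \in Delta f -> #|S| = (d - 2)%N ->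
     at_most_one_pos_eigenvalue (hessian (linkV f S) (linkpoly f S))) ->
  S \in skel -> (#|S| + (size us).+2 = d)%N ->
  (forall u, u \in us -> flat S u) -> lorentz_form (qf S us).
Proof.
move=> [_ C] Q; elim: us S => [|v us IH] S SK Sd uF.
  apply/lorentz_hessian => //; apply: at_most_one_pos_lorentz.
    exact: hessian_sym.
  by rewrite -hessian_linkpoly //; apply: Q; [exact: skel_Delta | rewrite -Sd addnK].
have {}Sd : (#|S| + (size us).+3 = d)%N by [].
apply: lorentz_step => //; first by apply: C => //; rewrite cpx_rank_skel; lia.
move=> i iV; apply: IH; first by apply: setU1_skel => //; lia.
  by move: iV; rewrite in_linkV => /andP[iS _];
    rewrite cardsU1 iS -Sd add1n addSn !addnS.
move=> u uus; apply: (@flat_sub S); first exact: subsetUr.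
by apply: uF; rewrite in_cons uus orbT.
Qed.

Lemma lorentzian_link S : S \in skel ->
  (forall us, (#|S| + (size us).+2 = d)%N -> (forall u, u \in us -> flat S u) ->
     lorentz_form (qf S us)) ->
  lorentzian (d - #|S|) (linkV f S) (hcone (d - #|S|) (linkV f S) (linkpoly f S))
    (linkpoly f S).
Proof.
move=> SK L; have Sd := skel_card SK.
have FL y : hcone (d - #|S|) (linkV f S) (linkpoly f S) y ->
    flat S y /\ supported (linkV f S) y.
  by move=> yc; split; [exact: hcone_linkV_flat | exact: hcone_supported yc].
have e : (#|S| + (d - #|S|) = d)%N by lia.
move: (d - #|S|)%N e FL => [|k] e FL; first lia.
move=> vs vc.
have vF v : v \in tval vs -> flat S v /\ supported (linkV f S) v.
  by move=> /tnthP[j ->]; apply: FL; exact: vc.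
have {vc FL} : size vs = k.+1 by rewrite size_tuple.
case: vs vF => vs /= _ vF sz; split.
  rewrite linkpolyE iterD_rho ?mcoeff0_rho; last first.
    by move=> u /vF[_]; exact: supported_linkV.
  by apply: mixed_gt0 => // [|v /vF[] //]; rewrite sz.
move=> k1; case: vs vF sz => [|w1 [|w2 us]] //= vF sz; first lia.
have w1V : w1 \in [:: w1, w2 & us] by rewrite mem_head.
have usV u : u \in us -> u \in [:: w1, w2 & us] by move=> h; rewrite !in_cons h !orbT.
rewrite drop0 hessian_linkpoly; last by move=> u /usV/vF[].
have [w1F w1s] := vF _ w1V.
(* The form is positive at the first vector of the tuple, which forces a positive eigenvalue. *)
apply: (@lorentz_exactly_one_pos _ _ _ (coords (linkV f S) w1)).
- exact: hessian_sym.
- rewrite bform_qf !embed_coords //; apply: mixed_gt0 => //; first by rewrite -e -sz.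
  by move=> u; rewrite !in_cons => /or3P[/eqP ->|/eqP ->|/usV/vF[]].
- by apply/lorentz_hessian => //; apply: L => [|u /usV/vF[] //]; rewrite -e -sz.
Qed.

(** * From the Lorentzian property to (C) and (Q) *)

Lemma lorentzian_lorentz S : S \in skel -> (#|S|.+1 < d)%N ->
  lorentzian (d - #|S|) (linkV f S) (hcone (d - #|S|) (linkV f S) (linkpoly f S))
    (linkpoly f S) ->
  exists y us, [/\ (#|S| + (size us).+2 = d)%N,
    (forall u, u \in y :: us -> flat S u),
    (forall u, u \in us -> supported (linkV f S) u) &
    exactly_one_pos_eigenvalue (hessian (linkV f S) (iterD us (linkpoly f S)))].
Proof.
move=> SK Sd L; have [y yc] := hcone_nonempty SK.
have yF := hcone_linkV_flat SK yc; have ys := hcone_supported yc.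
have [k dk] : exists k, (d - #|S|)%N = k.+2 by exists (d - #|S|).-2; lia.
rewrite dk in L yc.
(* A single point of the cone, repeated, is an admissible tuple. *)
have [|_ /(_ isT)] := L (nseq_tuple k.+2 y).
  by move=> j; rewrite tnth_nseq.
rewrite /= drop0 => E; exists y, (nseq k y); split => //.
- by rewrite size_nseq -dk subnKC //; do 2!apply: ltnW.
- by move=> u; rewrite in_cons mem_nseq => /orP[/eqP -> //|/andP[_ /eqP ->]].
- by move=> u; rewrite mem_nseq => /andP[_ /eqP ->].
Qed.

Lemma lorentzian_connected S : S \in skel -> (#|S| + 2 < d)%N ->
  lorentzian (d - #|S|) (linkV f S) (hcone (d - #|S|) (linkV f S) (linkpoly f S))
    (linkpoly f S) -> connected (link skel S).
Proof.
move=> SK Sd; case/(lorentzian_lorentz SK ltac:(lia)) => y [us [sz yF us_s]].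
rewrite hessian_linkpoly // => /exactly_at_most_one_pos.
move/(at_most_one_pos_lorentz (hessian_sym _ _))/(lorentz_hessian _ SK) => L.
move=> i j; rewrite !vertices_link_skel; try lia; move=> iV jV.
set e := (fun a b => _); apply: contraT => nij.
have SD := skel_Delta SK.
have [F1 _] := yF y (mem_head _ _) S SD (subxx _).
have [|[p [ps p0] yp] _] := F1; first lia.
(* The component of [i]; its complement [B] contains [j]. *)
pose A := [set a in linkV f S | connect e i a].
pose B := linkV f S :\: A.
have inA a : (a \in A) = (a \in linkV f S) && connect e i a by rewrite in_set.
have inB a : (a \in B) = (a \in linkV f S) && ~~ connect e i a.
  by rewrite in_setD inA; case: (a \in linkV f S); rewrite ?andbT ?andbF.
have pAB : p = restr A p + restr B p.
  apply/rowP => a; rewrite !mxE inA inB; case: (boolP (a \in linkV f S)) => aV /=.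
    by case: (connect e i a); rewrite /= ?addr0 ?add0r.
  by rewrite addr0 ps.
have sub W : W \subset linkV f S -> supported (linkV f S) (restr W p).
  by move=> WV a aV; rewrite mxE ifF //; apply: contraNF aV; exact: (subsetP WV).
have AV : A \subset linkV f S by apply/subsetP => a; rewrite inA => /andP[].
have BV : B \subset linkV f S by exact: subsetDl.
have pos W a : W \subset linkV f S -> a \in W -> 0 < qf S us (restr W p) p.
  move=> WV aW; rewrite qfC -(qf_sim _ _ yp) qfC.
  apply: (qf_gt0 (i := a)) => //; first exact: sub.
  - move=> b; rewrite mxE; case: ifP => // bW; rewrite ltW // p0 //.
    exact: (subsetP WV).
  - exact: (subsetP WV).
  - by rewrite mxE aW p0 // (subsetP WV).
(* For [a] in [A] and [b] in [B], a face [b |: (a |: S)] would have size |S| + 2 < d, hence lie in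
   the skeleton and join [A] to [B]. So these mixed derivatives vanish. *)
have cross : qf S us (restr A p) (restr B p) = 0.
  rewrite qfE mixed_expand; last exact: sub.
  rewrite big1 // => a aV; rewrite mxE; case: ifPn => aA; last by rewrite mul0r.
  suff D0 : dirD (restr B p) (G (a |: S)) = 0.
    by rewrite [iterD _ _]/= dirD_iterD D0 raddf0 mcoeff0 mulr0.
  have <- : dirD 0 (G (a |: S)) = 0 by rewrite -(scale0r p) dirDZl scale0r.
  apply: dirD_eq => b; rewrite !mxE; case: ifPn => bB; last by left.
  right; move: aA bB; rewrite inA inB => /andP[_ ia] /andP[bV nib].
  have aS : a \notin S by move: aV; rewrite in_linkV => /andP[].
  have bS : b \notin S by move: bV; rewrite in_linkV => /andP[].
  have ba : b != a by apply: contraNneq nib => ->.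
  have baS : b \notin a |: S by rewrite in_setU1 negb_or ba.
  rewrite mderiv_G //; apply/eqP; rewrite -[_ == 0]negbK -in_Delta.
  apply: contra nib => D2; apply: connect_trans ia (connect1 _).
  rewrite /e in_link_skel -setI_eq0 setIUl setU_eq0 !setI_eq0 !disjoints1 aS bS /=.
  have -> : S :|: [set a; b] = b |: (a |: S).
    by apply/setP => c; rewrite !inE orbC -orbA orbCA.
  by rewrite in_skel_card D2 !cardsU1 baS aS !add1n; move: Sd; rewrite addn2.
have qD x1 x2 z : qf S us z (x1 + x2) = qf S us z x1 + qf S us z x2.
  by rewrite !(qfC _ _ z) !qfE dirDDl !raddfD.
have iA : i \in A by rewrite inA iV connect0.
have jB : j \in B by rewrite inB jV.
(* Without cross term, the value at each restriction is its positive pairing with [p]; two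
   orthogonal vectors of positive square contradict reverse Cauchy-Schwarz. *)
have := pos A i AV iA; rewrite {2}pAB qD cross addr0 => qA.
have := pos B j BV jB; rewrite {2}pAB qD [X in X + _]qfC cross add0r => qB.
have := L (restr A p) (restr B p) qB; rewrite cross expr0n /=.
by rewrite leNgt mulr_gt0.
Qed.

End HereditaryPolynomials.

(** * Proof of the equivalence *)

Theorem theorem3p8 (R : realType) (n d : nat) (f : {mpoly R[n]})
  (d_ge2 : (2 <= d)%N)
  (f_neq0 : f != 0)
  (f_homog : f \is d.-homog)
  (f_hereditary : hereditary f)
  (f_cone : exists v : 'rV[R]_n, hcone d [set: 'I_n] f v) :
  hereditary_lorentzian d f <->
  (H_connected (skeleton (Delta f)) /\
   (forall S : {set 'I_n}, S \in Delta f -> #|S| = (d - 2)%N ->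
      at_most_one_pos_eigenvalue (hessian (linkV f S) (linkpoly f S)))).
Proof.
have [x0 x0c] := f_cone; split => [[_ HL]|[C Q]].
  split; [split|].
  - exact: (pure_skel f_homog f_hereditary f_neq0 d_ge2 x0c).
  - move=> S SK; rewrite (cpx_rank_skel f_homog f_hereditary f_neq0 d_ge2 x0c) => Sd.
    apply: (lorentzian_connected f_homog f_hereditary f_neq0 d_ge2 x0c) => //.
      by rewrite -(ltn_predK d_ge2) ltnS.
    exact: HL.
  - move=> S SD Sd.
    have SK : S \in skeleton (Delta f).
      rewrite (in_skel_card f_homog f_hereditary f_neq0 d_ge2 x0c) SD Sd.
      by rewrite ltn_subrL (ltnW d_ge2).
    case: (lorentzian_lorentz f_homog f_hereditary f_neq0 d_ge2 x0c SK _ (HL S SK)).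
      by rewrite Sd; lia.
    move=> y [us [sz _ _ /exactly_at_most_one_pos]].
    (* For |S| = d - 2 no further derivative is taken, so this Hessian is the one in (Q). *)
    by have /size0nil -> : size us = 0%N by move: sz; rewrite Sd; lia.
split => // S SK.
apply: (lorentzian_link f_homog f_hereditary f_neq0 d_ge2 x0c) => // us sz uF.
exact: (lorentz_all f_homog f_hereditary f_neq0 d_ge2 x0c).
Qed.
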